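(* There exists a sequence $\{z_n\}_{n\in\mathbb{N}}$ in $\mathbb{D}\setminus\{0\}$ that is a zero set of $\mathcal{D}$ such that there does not exist a subset $C\subset\mathbb{N}$ such that (1) $\left\{\frac{z_n}{|z_n|}:n\in C\right\}$ is contained in a Carleson set, and (2) $\displaystyle\sum_{n\in\mathbb{N}\setminus C}\frac{1}{\log\left(\frac{1}{1-|z_n|}\right)}<\infty$.
   Context: $\mathbb{D}$ is the open unit disc in $\mathbb{C}$ and $\mathbb{T}$ the unit circle. The Dirichlet space $\mathcal{D}$ is the space of analytic functions $f$ on $\mathbb{D}$ with $\int_{\mathbb{D}}|f'|^2\,dA<\infty$ ($A$ normalized area measure). A sequence $Z$ in $\mathbb{D}$ (each point repeated finitely many times, repetitions encoding multiplicities) is a zero set of $\mathcal{D}$ if there is $f\in\mathcal{D}$ which has a zero of multiplicity exactly $m$ at each $z$ repeated $m$ times in $Z$ and satisfies $f(z)\ne0$ for all $z\in\mathbb{D}\setminus Z$. A compact set $E\subset\mathbb{T}$ is a Carleson set if $\int_{\mathbb{T}}\log\left(\frac{1}{\operatorname{dist}(z,E)}\right)|dz|<\infty$. *)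

(* Defs.v *)
(* MathComp-Analysis over an arbitrary [R : realType]; the complex numbers are
   [R[i]] from mathcomp.real_closed. *)
From HB Require Import structures.
From mathcomp Require Export all_boot all_order all_algebra.
From mathcomp Require Export complex.
From mathcomp Require Export all_classical all_reals all_analysis.
Set Implicit Arguments.
Unset Strict Implicit.
Unset Printing Implicit Defensive.
Export Order.TTheory GRing.Theory Num.Theory.
Export numFieldNormedType.Exports.
Global Open Scope classical_set_scope.
Global Open Scope complex_scope.
Global Open Scope ring_scope.

(* Equips [R[i]] with the topology and the one-dimensional normed module
   structure (over itself) that every [numFieldType] has. *)
HB.instance Definition _ (R : rcfType) := NormedModule.copy R[i] R[i]^o.

(* The modulus as an element of [R]: the norm [`|z|] of [R[i]] is itself
   an element of [R[i]]. *)
Definition cmod (R : realType) (z : R[i]) : R := Normc.normc z.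

Definition disc (R : realType) : set R[i] := [set z | cmod z < 1].

Definition circle (R : realType) : set R[i] := [set z | cmod z = 1].

Definition expi (R : realType) (t : R) : R[i] := cos t +i* sin t.

(* [derivable f z 1] and [f^`()] are taken over the field [R[i]]: complex
   differentiability and the complex derivative. *)
Definition analytic_disc (R : realType) (f : R[i] -> R[i]) : Prop :=
  forall z, disc z -> derivable f z 1.

Definition dirichlet_integral (R : realType) (f : R[i] -> R[i]) : \bar R :=
  ((pi^-1)%:E * \int[lebesgue_measure \x lebesgue_measure]_(p in
     [set p : R * R | disc (p.1 +i* p.2)])
     (cmod (f^`()%classic (p.1 +i* p.2)) ^+ 2)%:E)%E.

Definition dirichlet_space (R : realType) : set (R[i] -> R[i]) :=
  [set f | analytic_disc f /\ (dirichlet_integral f < +oo)%E].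

Definition zero_of_multiplicity (R : realType) (f : R[i] -> R[i]) (m : nat)
    (z : R[i]) : Prop :=
  exists g : R[i] -> R[i], [/\ analytic_disc g, g z != 0 &
    forall w, disc w -> f w = (w - z) ^+ m * g w].

(* The multiplicity of [w] in the sequence [z] is the number of indices [n]
   with [z n = w]. *)
Definition zero_set (R : realType) (z : nat -> R[i]) : Prop :=
  [/\ forall n, disc (z n),
      forall w, finite_set [set n | z n = w] &
      exists2 f, dirichlet_space f &
        (forall w m, range z w -> ([set n | z n = w] #= `I_m)%card ->
           zero_of_multiplicity f m w) /\
        (forall w, (@disc R `\` range z) w -> f w != 0)].

(* Extended-valued: [0^-1 = +oo] and [lne +oo = +oo] in [\bar R], so that the
   integrand in [carleson_set] is [+oo] on [E]; with real-valued [ln], for which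
   [ln 0 = 0], the whole circle would qualify. *)
Definition edist_set (R : realType) (z : R[i]) (E : set R[i]) : \bar R :=
  ereal_inf [set (cmod (z - w))%:E | w in E].

Definition carleson_set (R : realType) (E : set R[i]) : Prop :=
  [/\ compact E, E `<=` @circle R &
    (\int[lebesgue_measure]_(t in `[0%R, (2 * pi)%R])
       lne ((edist_set (expi t) E)^-1) < +oo)%E].

(* Main.v *)
(* Fix a unit vector zeta, put u = 1 - z / zeta (so Re u > 0 on the disc), let
   d = 2^-n, and let b be the convex combination of the quotients
   (u - d) / (u + 2^-i), 1 <= i <= n, with weights proportional to i.  Then
   |b| <= 1 and, since the sum of the weighted 1 / (u + 2^-i) has positive real
   part, the only zero of b is at u = d.  The zero of b ^ (15 n) has multiplicity
   comparable with log (1 / d), and yet its Dirichlet integral is O(n^(-1/2)):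
   the weights make b close to 1 at the large scales of |u|, and at the small
   ones, where b varies, |b| ^ n is already small.
   The product f over j of such powers, with n = 16^j and directions zeta_j,
   therefore lies in the Dirichlet space.  Each block of zeros has reciprocal
   logarithms summing to at least 1, so if the sum over the complement of C is
   finite, C meets all but finitely many blocks.  The directions zeta_j, j >= J,
   are dense in the circle for every J, so a set E containing them all is at
   distance 0 from every point of the circle. *)
Require Import Defs.
From mathcomp Require Import measurable_realfun ring lra zify.
Set Implicit Arguments.
Unset Strict Implicit.
Unset Printing Implicit Defensive.

(** * Moduli, geometric limits and complex derivatives *)

Section Modulus.
Variable R : realType.
Implicit Types (x y z : R[i]) (a : R).

Lemma normcE z : `|z| = (cmod z)%:C.
Proof. by []. Qed.

Lemma cmod_ge0 z : 0 <= cmod z.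
Proof. by case: z => a b; exact: sqrtr_ge0. Qed.

Lemma cmod0 : cmod (0 : R[i]) = 0.
Proof. exact: Normc.normc0. Qed.

Lemma cmod1 : cmod (1 : R[i]) = 1.
Proof. exact: Normc.normc1. Qed.

Lemma cmodM x y : cmod (x * y) = cmod x * cmod y.
Proof. exact: Normc.normcM. Qed.

Lemma cmodV x : cmod x^-1 = (cmod x)^-1.
Proof. exact: Normc.normcV. Qed.

Lemma cmodN x : cmod (- x) = cmod x.
Proof. exact: normcN. Qed.

Lemma cmodB x y : cmod (x - y) = cmod (y - x).
Proof. by rewrite -cmodN opprB. Qed.

Lemma cmodD x y : cmod (x + y) <= cmod x + cmod y.
Proof. exact: le_normcD. Qed.

Lemma cmodX x n : cmod (x ^+ n) = cmod x ^+ n.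
Proof. by elim: n => [|n IH]; rewrite ?cmod1 // !exprS cmodM IH. Qed.

Lemma cmod_eq0 x : (cmod x == 0) = (x == 0).
Proof.
apply/eqP/eqP => [|->]; [exact: Normc.eq0_normc | exact: cmod0].
Qed.

Lemma cmod_gt0 x : (0 < cmod x) = (x != 0).
Proof. by rewrite lt0r cmod_eq0 cmod_ge0 andbT. Qed.

Lemma cmodR a : cmod a%:C = `|a|.
Proof. by rewrite /cmod /= expr0n addr0 sqrtr_sqr. Qed.

Lemma cmod_sqr z : cmod z ^+ 2 = complex.Re z ^+ 2 + complex.Im z ^+ 2.
Proof. by case: z => a b; rewrite /cmod /= sqr_sqrtr// addr_ge0 ?sqr_ge0. Qed.

Lemma le_Re_cmod z : `|complex.Re z| <= cmod z.
Proof.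
by rewrite -ler_sqr ?nnegrE ?cmod_ge0// real_normK ?num_real// cmod_sqr lerDl sqr_ge0.
Qed.

Lemma le_Im_cmod z : `|complex.Im z| <= cmod z.
Proof.
by rewrite -ler_sqr ?nnegrE ?cmod_ge0// real_normK ?num_real// cmod_sqr lerDr sqr_ge0.
Qed.

Lemma cmod_le_ReIm z : cmod z <= `|complex.Re z| + `|complex.Im z|.
Proof.
rewrite -ler_sqr ?nnegrE ?cmod_ge0 ?addr_ge0// cmod_sqr sqrrD !real_normK ?num_real//.
by rewrite lerD2r lerDl mulrn_wge0// mulr_ge0.
Qed.

Lemma cmod_sum (I : Type) (r : seq I) (F : I -> R[i]) :
  cmod (\sum_(i <- r) F i) <= \sum_(i <- r) cmod (F i).
Proof.
elim/big_rec2: _ => [|i b c _ le_cb]; first by rewrite cmod0.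
by rewrite (le_trans (cmodD _ _))// lerD2l.
Qed.

Lemma Re_sum (I : Type) (r : seq I) (F : I -> R[i]) :
  complex.Re (\sum_(i <- r) F i) = \sum_(i <- r) complex.Re (F i).
Proof. by elim/big_rec2: _ => // i x [a b] _ <-; case: (F i). Qed.

End Modulus.

Section GeometricLimits.
Variable R : realType.

Lemma half_expn_small (e : R) : 0 < e -> exists N, 2^-1 ^+ N < e.
Proof.
move=> e0; exists (Num.truncn e^-1).
rewrite exprVn invf_plt ?posrE ?exprn_gt0//.
apply: (lt_le_trans (truncnS_gt _)).
by rewrite -natrX ler_nat ltn_expl.
Qed.

(** Shifting by the geometric tail [2 * C * 2^-1 ^+ J] makes [p] nondecreasing and [q]
    nonincreasing, so the supremum of [p] lies between the two. *)
Lemma real_geometric_cvg (x : nat -> R) (C : R) :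
  (forall J, `|x J.+1 - x J| <= C * 2^-1 ^+ J) ->
  exists l, forall J, `|x J - l| <= 2 * C * 2^-1 ^+ J.
Proof.
move=> xC.
have C0 : 0 <= C by have := le_trans (normr_ge0 _) (xC 0%N); rewrite expr0 mulr1.
pose p J := x J - 2 * C * 2^-1 ^+ J; pose q J := x J + 2 * C * 2^-1 ^+ J.
have h0 J : 0 <= 2^-1 ^+ J :> R by rewrite exprn_ge0.
have pinc : nondecreasing_seq p.
  apply/nondecreasing_seqP => J; have := xC J; rewrite ler_norml /p exprS => /andP[].
  have := h0 J; nra.
have qdec : nonincreasing_seq q.
  apply/nonincreasing_seqP => J; have := xC J; rewrite ler_norml /q exprS => /andP[].
  have := h0 J; nra.
have pq J K : p J <= q K.
  apply: (le_trans (pinc _ _ (leq_maxl J K))).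
  apply: le_trans (qdec _ _ (leq_maxr J K)).
  by rewrite /p /q; have := mulr_ge0 C0 (h0 (maxn J K)); nra.
have hsup : has_sup (range p).
  split; first by exists (p 0%N), 0%N.
  by exists (q 0%N) => _ [J _ <-].
exists (sup (range p)) => J; rewrite ler_norml.
have h1 : p J <= sup (range p) by apply: sup_upper_bound => //; exists J.
have h2 : sup (range p) <= q J.
  by apply: ge_sup => [|_ [K _ <-]//]; exists (p 0%N), 0%N.
by move: h1 h2; rewrite /p /q => ? ?; apply/andP; split; lra.
Qed.

(** Convergence at an explicit geometric rate, so that limits are compared by the triangle
    inequality alone. For sequences of functions the constant may vary with the point. *)
Definition gcvg (a : nat -> R[i]) (l : R[i]) : Prop :=
  exists B : R, forall J, cmod (a J - l) <= B * 2^-1 ^+ J.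

Lemma geometric_cvg (a : nat -> R[i]) (C : R) :
  (forall J, cmod (a J.+1 - a J) <= C * 2^-1 ^+ J) ->
  exists l, forall J, cmod (a J - l) <= 4 * C * 2^-1 ^+ J.
Proof.
move=> aC.
have ReB x y : complex.Re x - complex.Re y = complex.Re (x - y) :> R.
  by case: x y => [? ?] [? ?].
have ImB x y : complex.Im x - complex.Im y = complex.Im (x - y) :> R.
  by case: x y => [? ?] [? ?].
have [J|l lP] := @real_geometric_cvg (fun J => complex.Re (a J)) C.
  by apply: le_trans (aC J); rewrite ReB le_Re_cmod.
have [J|m mP] := @real_geometric_cvg (fun J => complex.Im (a J)) C.
  by apply: le_trans (aC J); rewrite ImB le_Im_cmod.
exists (l +i* m) => J. apply: (le_trans (@cmod_le_ReIm R _)).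
have := lP J; have := mP J; case: (a J) => [u v] /=; lra.
Qed.

Lemma small_eq0 (x : R) : 0 <= x -> (forall e, 0 < e -> x <= e) -> x = 0.
Proof.
move=> x0 xe; apply/eqP; rewrite eq_le x0 andbT; apply/ler_addgt0Pr => e e0.
by rewrite add0r xe.
Qed.

Lemma geometric_small (B e : R) : 0 < e -> exists N, forall J, (N <= J)%N ->
  B * 2^-1 ^+ J <= e.
Proof.
move=> e0; have B0 : 0 < `|B| + 1 by rewrite ltr_wpDl.
have [N NP] := half_expn_small (divr_gt0 e0 B0).
exists N => J NJ.
have : 2^-1 ^+ J <= e / (`|B| + 1).
  by apply: le_trans (ltW NP); apply: ler_wiXn2l => //; lra.
rewrite ler_pdivlMr// => h; apply: le_trans h; rewrite mulrC ler_wpM2l ?exprn_ge0//.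
by apply: (@le_trans _ _ `|B|); rewrite ?ler_norm// lerDl.
Qed.

Lemma gcvg_uniq a l m : gcvg a l -> gcvg a m -> l = m.
Proof.
move=> [B hB] [B' hB']; apply/eqP; rewrite -subr_eq0 -cmod_eq0; apply/eqP.
apply: small_eq0 (cmod_ge0 _) _ => e e0.
have [N /(_ N (leqnn _))] := @geometric_small (B + B') e e0.
apply: le_trans; rewrite mulrDl.
rewrite (_ : l - m = (a N - m) - (a N - l)); last by ring.
by rewrite (le_trans (cmodD _ _))// cmodN addrC lerD.
Qed.

End GeometricLimits.

(** * Complex differentiability by estimates, and limits of derivatives *)

Section Derivative.
Variable R : realType.
Implicit Types (f : R[i] -> R[i]) (z d : R[i]).

Lemma scale_selfE (a b : R[i]) : a *: b = a * b.
Proof. by []. Qed.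

Lemma is_derive_epsP f z d :
  is_derive z (1 : R[i]) f d <->
  forall e : R, 0 < e -> exists2 r : R, 0 < r & forall y, cmod (y - z) < r ->
    cmod (f y - f z - d * (y - z)) <= e * cmod (y - z).
Proof.
split=> [fd e e0|H].
  have [/cvg_ex[l fl] dl] := fd.
  have {dl} dl : l = d.
    rewrite -dl /derive; apply/esym/cvg_lim => //; exact: fl.
  move: fl; rewrite dl => /cvgrPdist_le /(_ e%:C); rewrite ltcR => /(_ e0).
  case => r /=; rewrite ltcE /= => /andP[/eqP rim r0] hr.
  exists (complex.Re r) => // y yr.
  have [->|yz] := eqVneq y z; first by rewrite !subrr mulr0 subr0 cmod0 mulr0.
  have yz0 : y - z != 0 by rewrite subr_eq0.
  have := hr (y - z); rewrite /= sub0r normrN normcE.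
  have -> : (cmod (y - z))%:C < r by rewrite ltcE /= rim eqxx.
  move=> /(_ isT yz0).
  rewrite [_ *: 1]mulr1 subrK normcE lecR => h.
  rewrite -[X in cmod X](_ : - ((d - (y - z)^-1 *: (f y - f z)) * (y - z)) = _).
    by rewrite cmodN cmodM ler_wpM2r// cmod_ge0.
  by rewrite scale_selfE; field.
have : h^-1 *: ((f \o shift z) (h *: (1 : R[i])) - f z) @[h --> 0^'] --> d.
  apply/cvgrPdist_le => e; rewrite ltcE /= => /andP[/eqP eim e0].
  have [r r0 hr] := H _ e0.
  exists r%:C; first by rewrite /= ltcR.
  move=> h /=; rewrite sub0r normrN normcE ltcR => hr1 h0.
  have := hr (h + z); rewrite addrK => /(_ hr1) h2.
  rewrite [_ *: 1]mulr1 normcE lecE /= eim eqxx /=.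
  have -> : d - h^-1 *: (f (h + z) - f z) = - ((f (h + z) - f z - d * h) / h).
    by rewrite scale_selfE; field.
  by rewrite cmodN cmodM cmodV ler_pdivrMr ?cmod_gt0.
move=> cv; split; first by apply/cvg_ex; exists d.
by rewrite /derive; apply/cvg_lim.
Qed.

(** Termwise differentiation without Cauchy's formula: the increments from [z] of consecutive
    differences have geometrically decaying Lipschitz constants. Hence the [dG J] form a geometric
    Cauchy sequence, and the difference quotients at [z] converge uniformly. *)
Lemma derive_gcvg_limit (G : nat -> R[i] -> R[i]) (F : R[i] -> R[i]) z (r C : R)
    (dG : nat -> R[i]) :
  0 < r -> (forall J, is_derive z (1 : R[i]) (G J) (dG J)) ->
  (forall J y, cmod (y - z) < r ->
     cmod ((G J.+1 y - G J y) - (G J.+1 z - G J z)) <= C * 2^-1 ^+ J * cmod (y - z)) ->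
  (forall y, cmod (y - z) < r -> gcvg (G^~ y) (F y)) ->
  exists2 d, is_derive z (1 : R[i]) F d & gcvg dG d.
Proof.
move=> r0 GdG GC GF.
have dGC J : cmod (dG J.+1 - dG J) <= C * 2^-1 ^+ J.
  apply/ler_addgt0Pr => e e0.
  have e20 : 0 < e / 2 by rewrite divr_gt0.
  have /is_derive_epsP/(_ _ e20)[r1 r10 h1] := GdG J.
  have /is_derive_epsP/(_ _ e20)[r2 r20 h2] := GdG J.+1.
  (* A displacement within all three radii; dividing by it transfers the Lipschitz constant to the
     derivatives, up to [e]. *)
  pose t : R := Num.min r (Num.min r1 r2) / 2.
  have m0 : 0 < Num.min r (Num.min r1 r2) by rewrite !lt_min r0 r10.
  have t0 : 0 < t by rewrite divr_gt0.
  have tm : t < Num.min r (Num.min r1 r2) by rewrite /t; lra.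
  move: tm; rewrite !lt_min => /and3P[tr tr1 tr2].
  pose y := z + t%:C.
  have yzE : y - z = t%:C by rewrite /y addrC addKr.
  have yz : cmod (y - z) = t by rewrite yzE cmodR gtr0_norm.
  have {}h1 := h1 y; have {}h2 := h2 y; have h3 := GC J y.
  rewrite !yz in h1 h2 h3.
  have {}h1 := h1 tr1; have {}h2 := h2 tr2; have {}h3 := h3 tr.
  rewrite -(ler_pM2r t0) -{1}yz -cmodM.
  rewrite (_ : (dG J.+1 - dG J) * (y - z) =
     (G J.+1 y - G J y - (G J.+1 z - G J z)) + ((G J y - G J z - dG J * (y - z)) -
     (G J.+1 y - G J.+1 z - dG J.+1 * (y - z)))); last by ring.
  apply: (le_trans (cmodD _ _)).
  rewrite mulrDl lerD//; apply: (le_trans (cmodD _ _)).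
  by rewrite cmodN (splitr e) mulrDl lerD.
have [d dP] := geometric_cvg dGC.
exists d; last by eexists; exact: dP.
apply/is_derive_epsP => e e0.
have e20 : 0 < e / 2 by rewrite divr_gt0.
(* One [4 * C] accounts for [dG N - d], the other for the tail of the increments; the other half of
   [e] is the error of [G N] itself. *)
have [N /(_ N (leqnn N)) NP] := @geometric_small R (4 * C + 4 * C) (e / 2) e20.
have /is_derive_epsP/(_ _ e20)[r1 r10 h1] := GdG N.
exists (Num.min r r1) => [|y]; first by rewrite lt_min r0.
rewrite lt_min => /andP[yr yr1].
have zr : cmod (z - z) < r by rewrite subrr cmod0.
have [J|l lP] := @geometric_cvg R (fun J => G J y - G J z) (C * cmod (y - z)).
  rewrite mulrAC; apply: le_trans (GC J y yr).
  by rewrite le_eqVlt; apply/orP; left; apply/eqP; congr cmod => /=; ring.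
have lE : l = F y - F z.
  apply: (@gcvg_uniq R (fun J => G J y - G J z)); first by eexists; exact: lP.
  have [B hB] := GF y yr; have [B' hB'] := GF z zr.
  exists (B + B') => J; rewrite mulrDl.
  rewrite (_ : G J y - G J z - (F y - F z) = (G J y - F y) - (G J z - F z)); last by ring.
  by rewrite (le_trans (cmodD _ _))// cmodN lerD.
rewrite (_ : F y - F z - d * (y - z) = (G N y - G N z - dG N * (y - z)) + ((dG N - d) * (y - z) -
   (G N y - G N z - (F y - F z)))); last by ring.
apply: (le_trans (cmodD _ _)); rewrite [X in _ <= X * _](splitr e) [X in _ <= X]mulrDl lerD ?h1//.
apply: (le_trans (cmodD _ _)); rewrite cmodN -lE.
have := lP N; have := dP N; rewrite cmodM; have := cmod_ge0 (y - z).
move: (cmod (y - z)) (cmod (dG N - d)) (cmod (_ - l)) NP => A X Y.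
move: (2^-1 ^+ N) => w; nra.
Qed.

End Derivative.

(** * Infinite products *)

Section InfiniteProduct.
Variable R : realType.
Implicit Types (h : nat -> R[i] -> R[i]) (z : R[i]).

Lemma cmod_prod_le1 (a : nat -> R[i]) J : (forall i, cmod (a i) <= 1) ->
  cmod (\prod_(i < J) a i) <= 1.
Proof.
move=> a1; elim: J => [|J IH]; first by rewrite big_ord0 cmod1.
by rewrite big_ord_recr cmodM mulr_ile1// cmod_ge0.
Qed.

Lemma cmod_prodB_le (a b : nat -> R[i]) J :
  (forall i, cmod (a i) <= 1) -> (forall i, cmod (b i) <= 1) ->
  cmod (\prod_(i < J) a i - \prod_(i < J) b i) <= \sum_(i < J) cmod (a i - b i).
Proof.
move=> a1 b1; elim: J => [|J IH]; first by rewrite !big_ord0 subrr cmod0.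
rewrite !big_ord_recr /=.
rewrite (_ : _ - _ = (\prod_(i < J) a i - \prod_(i < J) b i) * a J +
  \prod_(i < J) b i * (a J - b J)); last by ring.
apply: (le_trans (cmodD _ _)); rewrite !cmodM lerD//.
  by apply: le_trans IH; rewrite ler_piMr ?cmod_ge0.
by rewrite ler_piMl ?cmod_ge0// cmod_prod_le1.
Qed.

Lemma sum_half_le2 (x : nat -> R) (C : R) J : 0 <= C ->
  (forall i, x i <= C * 2^-1 ^+ i) -> \sum_(i < J) x i <= 2 * C.
Proof.
move=> C0 xC; suff : \sum_(i < J) x i <= 2 * C - 2 * C * 2^-1 ^+ J.
  have : 0 <= C * 2^-1 ^+ J by rewrite mulr_ge0// exprn_ge0.
  lra.
elim: J => [|J IH]; first by rewrite big_ord0 expr0; lra.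
by rewrite big_ord_recr /= exprS; have := xC J; lra.
Qed.

(** Smallness of [h j z - 1] makes the product converge; the Lipschitz bound, summable in [j] on
    each smaller disc, permits termwise differentiation. Modulus at most 1 keeps every partial
    product bounded by 1. *)
Definition tame_factors h : Prop :=
  [/\ forall j z, disc z -> cmod (h j z) <= 1,
      forall j z, disc z -> derivable (h j) z 1 &
      forall r : R, r < 1 -> exists2 C : R, 0 <= C &
        forall j y z, cmod y <= r -> cmod z <= r ->
          cmod (h j z - 1) <= C * 2^-1 ^+ j /\
          cmod (h j y - h j z) <= C * 2^-1 ^+ j * cmod (y - z)].

Definition infprod h z : R[i] := xget 0 [set l | gcvg (fun J => \prod_(i < J) h i z) l].

Lemma tame_factors_shift h J : tame_factors h -> tame_factors (fun j => h (J + j)%N).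
Proof.
case=> h1 hd hC; split=> [j|j|r r1]; [exact: h1|exact: hd|].
have [C C0 CP] := hC r r1; exists C => // j y z yr zr.
have w : C * 2^-1 ^+ (J + j) <= C * 2^-1 ^+ j.
  by rewrite ler_wpM2l//; apply: ler_wiXn2l; rewrite ?leq_addl//; lra.
have [l1 l2] := CP (J + j)%N y z yr zr; split; first exact: le_trans w.
by apply: (le_trans l2); rewrite ler_wpM2r// cmod_ge0.
Qed.

Lemma infprodP h z : tame_factors h -> disc z ->
  gcvg (fun J => \prod_(i < J) h i z) (infprod h z).
Proof.
move=> [h1 hd hC] z1; rewrite /infprod; case: xgetP => [l _ //|/= nol].
have [C C0 CP] := hC _ z1.
have [J|l lP] := @geometric_cvg R (fun J => \prod_(i < J) h i z) C.
  rewrite big_ord_recr /= -[X in _ - X]mulr1 -mulrBr cmodM.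
  have [+ _] := CP J z z (lexx _) (lexx _); apply: le_trans.
  rewrite ler_piMl ?cmod_ge0//.
  by apply: (@cmod_prod_le1 (fun i => h i z)) => i; exact: h1.
by case: (nol l); eexists; exact: lP.
Qed.

Lemma infprod_split h z J : tame_factors h -> disc z ->
  infprod h z = \prod_(i < J) h i z * infprod (fun j => h (J + j)%N) z.
Proof.
move=> hT z1; have [B BP] := infprodP hT z1.
have [B' BP'] := infprodP (tame_factors_shift J hT) z1.
apply: (@gcvg_uniq R (fun K => \prod_(i < J + K) h i z)).
  exists B => K; apply: (le_trans (BP _)).
  have B0 : 0 <= B.
    by have := le_trans (cmod_ge0 _) (BP 0%N); rewrite expr0 mulr1.
  by rewrite ler_wpM2l//; apply: ler_wiXn2l; rewrite ?leq_addl//; lra.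
exists (cmod (\prod_(i < J) h i z) * B') => K.
by rewrite big_split_ord /= -mulrBr cmodM -mulrA ler_wpM2l ?cmod_ge0 ?BP'.
Qed.

(** Beyond some [J] the partial products of the tail stay within 1/4 of 1, so their limit is not 0;
    the finitely many earlier factors are nonzero. *)
Lemma infprod_neq0 h z : tame_factors h -> disc z -> (forall j, h j z != 0) ->
  infprod h z != 0.
Proof.
move=> hT z1 h0; have [h1 _ /(_ _ z1)[C C0 CP]] := hT.
have e0 : 0 < 4^-1 :> R by rewrite invr_gt0.
have [J JP] := geometric_small (2 * C) e0.
have {JP} /= JP := JP J (leqnn J).
rewrite (infprod_split J hT z1) mulf_neq0//; first by apply/prodf_neq0.
have [B BP] := infprodP (tame_factors_shift J hT) z1.
have [N NP] := geometric_small B e0.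
have {}NP := NP N (leqnn N); have {}BP := BP N.
set p := \prod_(i < N) _ in BP; set t := infprod _ _ in BP *.
have p1 : cmod (p - 1) <= 4^-1.
  rewrite (_ : 1 = \prod_(i < N) (fun=> 1) (i : nat)); last by rewrite big1.
  rewrite /p; apply: (le_trans (@cmod_prodB_le (fun i => h (J + i)%N z) (fun=> 1) N _ _)) => [i|i|].
  - exact: h1.
  - by rewrite cmod1.
  apply: le_trans JP; rewrite -mulrA; apply: (@sum_half_le2 (fun i => cmod (h (J + i)%N z - 1))).
    by rewrite mulr_ge0// exprn_ge0.
  by move=> i; rewrite -mulrA -exprD; have [] := CP (J + i)%N z z (lexx _) (lexx _).
apply/eqP => t0; move: BP; rewrite t0 subr0.
have := cmodD (1 - p) p; rewrite subrK cmod1 cmodB; lra.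
Qed.

Lemma prod_derive h (dh : nat -> R[i]) z J : disc z ->
  (forall j, cmod (h j z) <= 1) ->
  (forall j, is_derive z (1 : R[i]) (h j) (dh j)) ->
  exists2 d, is_derive z (1 : R[i]) (fun y => \prod_(i < J) h i y) d &
    cmod d <= \sum_(i < J) cmod (dh i).
Proof.
move=> z1 h1 hd; elim: J => [|J [d dP dle]].
  exists 0; last by rewrite big_ord0 cmod0.
  rewrite (_ : (fun _ => _) = cst 1); first exact: is_derive_cst.
  by apply/funext => y; rewrite big_ord0.
exists ((\prod_(i < J) h i z) *: dh J + h J z *: d).
  rewrite (_ : (fun _ => _) = (fun y => \prod_(i < J) h i y) * h J).
    by have := hd J; move=> ?; exact: is_deriveM.
  by apply/funext => y; rewrite big_ord_recr.
rewrite big_ord_recr /= [X in _ <= X]addrC; apply: (le_trans (cmodD _ _)).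
rewrite lerD//.
  rewrite scale_selfE cmodM ler_piMl ?cmod_ge0//.
  exact: (@cmod_prod_le1 (fun i => h i z)).
by apply: le_trans dle; rewrite scale_selfE cmodM ler_piMl ?cmod_ge0.
Qed.

(** The derivative is recorded as the limit of the derivatives of the partial products, with their
    bounds: the energy estimate is made for these and then passed to the limit. *)
Lemma infprod_derive h (dh : nat -> R[i]) z : tame_factors h -> disc z ->
  (forall j, is_derive z (1 : R[i]) (h j) (dh j)) ->
  exists2 d, is_derive z (1 : R[i]) (infprod h) d &
    exists2 dG, gcvg dG d & forall J, cmod (dG J) <= \sum_(i < J) cmod (dh i).
Proof.
move=> hT z1 hd; have [h1 _ hC] := hT.
(* Half the distance to the circle: the ball of radius [r] about [z] stays in a smaller disc, where
   the constants of [tame_factors] are uniform. *)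
pose r : R := (1 - cmod z) / 2.
have r0 : 0 < r by rewrite divr_gt0// subr_gt0.
have zr y : cmod (y - z) < r -> cmod y <= cmod z + r.
  by move=> yz; rewrite -[y](subrK z) addrC (le_trans (cmodD _ _))// lerD2l ltW.
have zr1 : cmod z + r < 1.
  have : cmod z < 1 by exact: z1.
  by rewrite /r; lra.
have zr1d y : cmod (y - z) < r -> disc y by move=> /zr yz; apply: le_lt_trans zr1.
have [C C0 CP] := hC _ zr1.
have zz : cmod (z - z) < r by rewrite subrr cmod0.
have /choice[dG dGP] : forall J, exists d, is_derive z (1 : R[i]) (fun y => \prod_(i < J) h i y) d /\
    cmod d <= \sum_(i < J) cmod (dh i).
  by move=> J; have [d ? ?] := prod_derive J z1 (fun j => h1 j z z1) hd; exists d.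
have [|y yz|d dP dGd] := @derive_gcvg_limit R (fun J y => \prod_(i < J) h i y) (infprod h) z
    r (2 * C * C + C) dG r0 (fun J => (dGP J).1).
- move=> J y yr; have yd := zr1d _ yr.
  rewrite !big_ord_recr /=.
  set py := \prod_(_ < _) h _ y; set pz := \prod_(_ < _) h _ z.
  have ppC : cmod (py - pz) <= 2 * C * cmod (y - z).
    apply: (le_trans (@cmod_prodB_le (h^~ y) (h^~ z) J _ _)) => [i|i|]; [exact: h1|exact: h1|].
    rewrite -mulrA; apply: (@sum_half_le2 (fun i => cmod (h i y - h i z))).
      by rewrite mulr_ge0// cmod_ge0.
    move=> i; rewrite mulrAC.
    by have [] := CP i y z (zr _ yr) (zr _ zz).
  (* The two terms of this splitting produce the constants [2 * C * C] and [C]. *)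
  rewrite (_ : py * h J y - py - (pz * h J z - pz) =
    (py - pz) * (h J y - 1) + pz * (h J y - h J z)); last by ring.
  apply: (le_trans (cmodD _ _)); rewrite !cmodM.
  have [h3 _] := CP J z y (zr _ zz) (zr _ yr).
  have [_ h4] := CP J y z (zr _ yr) (zr _ zz).
  have pz1 : cmod pz <= 1 by apply: (@cmod_prod_le1 (fun i => h i z)) => i; exact: h1.
  have := ler_pM (cmod_ge0 _) (cmod_ge0 _) ppC h3.
  have := ler_pM (cmod_ge0 _) (cmod_ge0 _) pz1 h4.
  lra.
- by apply: infprodP => //; exact: zr1d yz.
by exists d => //; exists dG => // J; case: (dGP J).
Qed.

Lemma infprod_analytic h : tame_factors h -> analytic_disc (infprod h).
Proof.
move=> hT z z1; have [_ hd _] := hT.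
have [|d [dP _] _] := @infprod_derive h (fun j => 'D_1 (h j) z) z hT z1 => //.
by move=> j; apply: derivableP; exact: hd.
Qed.

End InfiniteProduct.

(** * A bounded function with one zero, almost constant at large scales *)

Section WeightedSums.
Variable R : realType.

Lemma half_expn_gt0 i : 0 < 2^-1 ^+ i :> R.
Proof. by rewrite exprn_gt0. Qed.

Lemma half_expn_le i j : (i <= j)%N -> 2^-1 ^+ j <= 2^-1 ^+ i :> R.
Proof. by move=> ij; apply: ler_wiXn2l => //; lra. Qed.

Lemma sum_succ n : \sum_(i < n) i.+1%:R = n%:R * (n%:R + 1) / 2 :> R.
Proof.
elim: n => [|n IH]; first by rewrite big_ord0 mul0r mul0r.
by rewrite big_ord_recr /= IH -natr1; field.
Qed.

(** Meant for x_i = 2^-i / |u + 2^-i|^2 with |u| of size 2^-s: the first bound governs the indices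
    up to [s], the second those beyond. The second is conditional because at the last scale there is
    no lower bound on |u|. *)
Lemma sum_succ_geometric (x : nat -> R) (s k : nat) : (forall i, x i <= 2 ^+ i) ->
  ((0 < k)%N -> forall i, x i <= 4 ^+ s * 2^-1 ^+ i) ->
  \sum_(i < s + k) i.+1%:R * x i.+1 <= 2 ^+ s * (3 * s%:R + 2).
Proof.
move=> x1 x2.
have A : \sum_(i < s) i.+1%:R * x i.+1 <= 2 * s%:R * 2 ^+ s.
  elim: s {x2} => [|s IH]; first by rewrite big_ord0 mulr0 mul0r.
  rewrite big_ord_recr /=.
  have h : s.+1%:R * x s.+1 <= s.+1%:R * 2 ^+ s.+1 by rewrite ler_wpM2l.
  have p : 0 <= 2 ^+ s :> R by rewrite exprn_ge0.
  apply: (le_trans (lerD IH h)); rewrite -natr1 exprS; nra.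
have p : 0 <= 2 ^+ s :> R by rewrite exprn_ge0.
have s0 : 0 <= s%:R :> R by [].
case: k x2 => [_|k x2]; first by rewrite addn0; apply: (le_trans A); nra.
have {}x2 := x2 isT.
have e4 : 4 ^+ s * 2^-1 ^+ s = 2 ^+ s :> R by rewrite -exprMn; congr (_ ^+ _); field.
(* The subtracted term is the exact remainder of the series of (i+1) 2^-(i+1), so the induction step
   closes with an equality. *)
suff B j : \sum_(i < s + j) i.+1%:R * x i.+1 <= 2 * s%:R * 2 ^+ s + 2 ^+ s * (s%:R + 2)
     - 4 ^+ s * (s%:R + j%:R + 2) * 2^-1 ^+ (s + j).
  apply: (le_trans (B k.+1)).
  have : 0 <= 4 ^+ s * (s%:R + k.+1%:R + 2) * 2^-1 ^+ (s + k.+1) :> R.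
    by rewrite !mulr_ge0 ?exprn_ge0// !addr_ge0.
  nra.
elim: j => [|j IH].
  by rewrite !addn0 addr0 [X in _ - X]mulrAC e4; apply: (le_trans A); lra.
rewrite addnS big_ord_recr /=.
have h : (s + j).+1%:R * x (s + j).+1 <= (s + j).+1%:R * (4 ^+ s * 2^-1 ^+ (s + j).+1).
  by rewrite ler_wpM2l.
apply: (le_trans (lerD IH h)); rewrite exprS -!natr1 natrD.
by rewrite le_eqVlt; apply/orP; left; apply/eqP; field.
Qed.

Lemma sum_halved_head (w : nat -> R) k j :
  \sum_(i < k + j) w i * (if (i < k)%N then 2^-1 else 1) =
  \sum_(i < k + j) w i - 2^-1 * \sum_(i < k) w i.
Proof.
rewrite !big_split_ord /= (eq_bigr (fun i : 'I_k => 2^-1 * w i)); last first.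
  by move=> i _; rewrite ltn_ord mulrC.
rewrite -mulr_sumr [X in _ + X](eq_bigr (fun i : 'I_j => w (k + i)%N)); first by lra.
by move=> i _; rewrite ltnNge leq_addr mulr1.
Qed.

(** An algebraic form of exponential decay: the factor 1 / (1 + n x) is all that is used of the
    power. *)
Lemma bernoulli_inv (x : R) n : 0 <= x -> x <= 1 -> (1 - x) ^+ n * (1 + n%:R * x) <= 1.
Proof.
move=> x0 x1; elim: n => [|n IH]; first by rewrite expr0 mul0r addr0 mulr1.
apply: le_trans IH; rewrite exprSr -mulrA ler_wpM2l ?exprn_ge0 ?subr_ge0//.
have n0 : 0 <= n%:R :> R by []. 
rewrite -natr1; nra.
Qed.

(** Telescoping, from 1 / (a+1)^2 <= 1/a - 1/(a+1). *)
Lemma sum_inv_sqr m n : (0 < m)%N ->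
  \sum_(s < n) ((m + s.+1)%:R ^+ 2)^-1 <= m%:R^-1 :> R.
Proof.
move=> m0; suff : \sum_(s < n) ((m + s.+1)%:R ^+ 2)^-1 <= m%:R^-1 - (m + n)%:R^-1 :> R.
  by move=> h; apply: (le_trans h); rewrite lerBlDr lerDl invr_ge0.
elim: n => [|n IH]; first by rewrite big_ord0 addn0 subrr.
rewrite big_ord_recr /=; apply: (le_trans (lerD IH (lexx _))).
rewrite -addrA lerD2l addnS -natr1.
have a0 : 0 < (m + n)%:R :> R by rewrite ltr0n addn_gt0 m0.
move: (_%:R) a0 => a a0.
rewrite -subr_ge0 (_ : _ - _ = (a * (a + 1) ^+ 2)^-1).
  by rewrite invr_ge0 mulr_ge0 ?sqr_ge0// ltW.
by field; apply/andP; split; lra.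
Qed.

End WeightedSums.

(** * The base function on the right half-plane *)

Section BaseFunction.
Variable R : realType.
Implicit Types (u v : R[i]) (e d : R).

Lemma Re_addR u e : complex.Re (u + e%:C) = complex.Re u + e.
Proof. by case: u. Qed.

Lemma sqr_cmod_addR u e : cmod (u + e%:C) ^+ 2 = cmod u ^+ 2 + 2 * e * complex.Re u + e ^+ 2.
Proof. by rewrite !cmod_sqr; case: u => a b /=; ring. Qed.

Lemma addR_neq0 u e : 0 < complex.Re u -> 0 <= e -> u + e%:C != 0.
Proof.
move=> u0 e0; apply/eqP => /(congr1 (@complex.Re R)); rewrite Re_addR /=; lra.
Qed.

Lemma le_cmod_addR u e : 0 < complex.Re u -> 0 <= e ->
  [/\ cmod u <= cmod (u + e%:C), e <= cmod (u + e%:C) & complex.Re u <= cmod (u + e%:C)].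
Proof.
move=> u0 e0; have hp : 0 <= e * complex.Re u by rewrite mulr_ge0// ltW.
split.
- rewrite -ler_sqr ?nnegrE ?cmod_ge0// sqr_cmod_addR.
  by have := sqr_ge0 e; lra.
- rewrite -ler_sqr ?nnegrE ?cmod_ge0// sqr_cmod_addR.
  by have := sqr_ge0 (cmod u); lra.
- apply: (@le_trans _ _ (complex.Re (u + e%:C))); first by rewrite Re_addR lerDl.
  by apply: (le_trans (ler_norm _)); exact: le_Re_cmod.
Qed.

(** In the squared moduli the cross terms are -2d Re u and 2e Re u, and d^2 <= e^2. Hence every
    quotient in [base] has modulus at most 1. *)
Lemma cmod_subR_le u d e : 0 < complex.Re u -> 0 <= d -> d <= e ->
  cmod (u - d%:C) <= cmod (u + e%:C).
Proof.
move=> u0 d0 de; rewrite -ler_sqr ?nnegrE ?cmod_ge0//.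
rewrite -(rmorphN (@real_complex_def _ (Phant R))) !sqr_cmod_addR.
have h1 : 0 <= d * complex.Re u by rewrite mulr_ge0// ltW.
have h2 : 0 <= e * complex.Re u by rewrite mulr_ge0 ?(le_trans d0 de)// ltW.
have h3 : d ^+ 2 <= e ^+ 2 by rewrite ler_sqr ?nnegrE// (le_trans d0 de).
rewrite sqrrN; lra.
Qed.

Lemma Re_inv_gt0 u : 0 < complex.Re u -> 0 < complex.Re u^-1.
Proof.
case: u => a b /= a0; rewrite divr_gt0//.
by rewrite ltr_wpDr ?sqr_ge0// exprn_gt0.
Qed.

Definition weight (n i : nat) : R := 2 * i%:R / (n%:R * (n%:R + 1)).

Lemma weight_ge0 n i : 0 <= weight n i.
Proof. by rewrite /weight !mulr_ge0// invr_ge0 mulr_ge0// addr_ge0. Qed.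

Definition base (n : nat) u : R[i] :=
  \sum_(i < n) (weight n i.+1)%:C *
    ((u - (2^-1 ^+ n)%:C) / (u + (2^-1 ^+ i.+1)%:C)).

Definition base_cofactor (n : nat) u : R[i] :=
  \sum_(i < n) (weight n i.+1)%:C / (u + (2^-1 ^+ i.+1)%:C).

(** The divided difference of [base] between [u] and [v]; on the diagonal it is the derivative. *)
Definition base_slope (n : nat) u v : R[i] :=
  \sum_(i < n) (weight n i.+1)%:C * ((2^-1 ^+ i.+1 + 2^-1 ^+ n)%:C /
    ((u + (2^-1 ^+ i.+1)%:C) * (v + (2^-1 ^+ i.+1)%:C))).

Variable n : nat.
Hypothesis n_gt0 : (0 < n)%N.

Lemma sum_weight : \sum_(i < n) weight n i.+1 = 1.
Proof.
have n0 : n%:R != 0 :> R by rewrite pnatr_eq0 -lt0n.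
have n1 : n%:R + 1 != 0 :> R by rewrite natr1 pnatr_eq0.
rewrite /weight -mulr_suml -mulr_sumr sum_succ; field.
by rewrite n0 n1.
Qed.

Lemma base_factor u : base n u = (u - (2^-1 ^+ n)%:C) * base_cofactor n u.
Proof. by rewrite /base mulr_sumr; apply: eq_bigr => i _; ring. Qed.

Lemma base_cofactor_neq0 u : 0 < complex.Re u -> base_cofactor n u != 0.
Proof.
move=> u0; suff : 0 < complex.Re (base_cofactor n u).
  by apply: contraTneq => ->; rewrite /= ltxx.
rewrite Re_sum; case: n n_gt0 => // k _; rewrite big_ord_recr /=.
have ReZ (a : R) (x : R[i]) : complex.Re (a%:C * x) = a * complex.Re x.
  by case: x => x y /=; ring.
rewrite ltr_wpDl//.
  apply: sumr_ge0 => i _; rewrite ReZ mulr_ge0 ?weight_ge0// ltW//.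
  by rewrite Re_inv_gt0// Re_addR addr_gt0// half_expn_gt0.
rewrite ReZ mulr_gt0//.
  by rewrite /weight divr_gt0// mulr_gt0// addr_gt0.
by rewrite Re_inv_gt0// Re_addR addr_gt0// half_expn_gt0.
Qed.

Lemma base_neq0 u : 0 < complex.Re u -> u != (2^-1 ^+ n)%:C -> base n u != 0.
Proof.
by move=> u0 ud; rewrite base_factor mulf_neq0 ?subr_eq0 ?base_cofactor_neq0.
Qed.

Lemma cmod_base_le u (rho : nat -> R) : 0 < complex.Re u ->
  (forall i, (i < n)%N -> cmod (u - (2^-1 ^+ n)%:C) <= rho i * cmod (u + (2^-1 ^+ i.+1)%:C)) ->
  cmod (base n u) <= \sum_(i < n) weight n i.+1 * rho i.
Proof.
move=> u0 urho; apply: (le_trans (cmod_sum _ _)); apply: ler_sum => i _.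
rewrite cmodM cmodR ger0_norm ?weight_ge0// ler_wpM2l ?weight_ge0//.
by rewrite cmodM cmodV ler_pdivrMr ?urho// cmod_gt0 addR_neq0// ltW// half_expn_gt0.
Qed.

Lemma cmod_base_le1 u : 0 < complex.Re u -> cmod (base n u) <= 1.
Proof.
move=> u0; rewrite -sum_weight.
have := @cmod_base_le u (fun=> 1) u0.
under eq_bigr do rewrite mulr1; apply => i ni; rewrite mul1r.
by rewrite cmod_subR_le// ?half_expn_le// ltW// half_expn_gt0.
Qed.

Lemma sub_base u v : 0 < complex.Re u -> 0 < complex.Re v ->
  base n u - base n v = (u - v) * base_slope n u v.
Proof.
move=> u0 v0; rewrite /base /base_slope mulr_sumr -sumrB; apply: eq_bigr => i _.
rewrite rmorphD; set a := (_ ^+ i.+1)%:C; set b := _%:C; set w := _%:C.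
have ua : u + a != 0 by rewrite addR_neq0// ltW// half_expn_gt0.
have va : v + a != 0 by rewrite addR_neq0// ltW// half_expn_gt0.
by field; rewrite ua va.
Qed.

Lemma sub1_base u : 0 < complex.Re u ->
  1 - base n u = \sum_(i < n) (weight n i.+1)%:C *
     ((2^-1 ^+ i.+1 + 2^-1 ^+ n)%:C / (u + (2^-1 ^+ i.+1)%:C)).
Proof.
move=> u0; have w1 : 1 = \sum_(i < n) (weight n i.+1)%:C :> R[i].
  by rewrite -rmorph_sum /= sum_weight.
rewrite [X in X - _]w1 -sumrB; apply: eq_bigr => i _.
rewrite rmorphD; set a := (_ ^+ i.+1)%:C; set b := _%:C; set w := _%:C.
have ua : u + a != 0 by rewrite addR_neq0// ltW// half_expn_gt0.
by field.
Qed.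

(** Since 2^-n <= 2^-(i+1), each numerator is at most twice 2^-(i+1); this 2 and the one in [weight]
    give the constant 4. *)
Lemma cmod_slope_sum_le (q : nat -> R[i]) (rho : nat -> R) :
  (forall i, (i < n)%N -> 2^-1 ^+ i.+1 * cmod (q i) <= rho i) ->
  cmod (\sum_(i < n) (weight n i.+1)%:C * ((2^-1 ^+ i.+1 + 2^-1 ^+ n)%:C * q i))
    <= 4 / (n%:R * (n%:R + 1)) * \sum_(i < n) i.+1%:R * rho i.
Proof.
move=> qr; apply: (le_trans (cmod_sum _ _)); rewrite mulr_sumr; apply: ler_sum => i _.
rewrite !cmodM !cmodR ger0_norm ?weight_ge0// ger0_norm ?addr_ge0 ?exprn_ge0//.
rewrite (_ : 4 / _ * _ = weight n i.+1 * (2 * rho i)); last by rewrite /weight; ring.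
rewrite ler_wpM2l ?weight_ge0//.
apply: le_trans (_ : 2 * (2^-1 ^+ i.+1 * cmod (q i)) <= _); last by rewrite ler_wpM2l// qr.
rewrite mulrA ler_wpM2r ?cmod_ge0//.
by have := @half_expn_le R _ _ (ltn_ord i); lra.
Qed.

Lemma sum_succ_half : \sum_(i < n) i.+1%:R * 2^-1 ^+ i.+1 <= 2 :> R.
Proof.
have := @sum_succ_geometric R (fun i => 2^-1 ^+ i) 0 n.
rewrite add0n !expr0 !mulr0 add0r !mul1r; apply => [i|_ i]; last by rewrite mul1r.
apply: (@le_trans _ _ 1); first by rewrite -(expr0 2^-1) half_expn_le.
by rewrite -natrX ler1n expn_gt0.
Qed.

(** With the denominators bounded below, the sum of i 2^-i stays bounded and only the normalisation
    n(n+1) of the weights remains. The rate n^-2 beats the exponent 15 n of the blocks. *)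
Lemma cmod_sub1_base_le u (r : R) : r < 1 -> 1 - r <= complex.Re u ->
  cmod (base n u - 1) <= 8 / (n%:R * (n%:R + 1)) / (1 - r).
Proof.
move=> r1 ur; have r0 : 0 < 1 - r by rewrite subr_gt0.
have u0 : 0 < complex.Re u by exact: lt_le_trans ur.
rewrite cmodB sub1_base//.
apply: (le_trans (@cmod_slope_sum_le (fun i => (u + (2^-1 ^+ i.+1)%:C)^-1)
  (fun i => 2^-1 ^+ i.+1 / (1 - r)) _)).
  move=> i ni; rewrite ler_wpM2l ?exprn_ge0// cmodV lef_pV2 ?posrE//.
    by have [_ _] := le_cmod_addR u0 (ltW (half_expn_gt0 R i.+1)); exact: le_trans.
  by rewrite cmod_gt0 addR_neq0// ltW// half_expn_gt0.
under eq_bigr do rewrite mulrA.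
rewrite -mulr_suml mulrA ler_wpM2r ?invr_ge0 ?(ltW r0)//.
rewrite (_ : 8 / _ = 4 / (n%:R * (n%:R + 1)) * 2); last by ring.
by rewrite ler_wpM2l ?sum_succ_half// divr_ge0// mulr_ge0// addr_ge0.
Qed.

Lemma cmod_sub_base_le u v (r : R) : r < 1 -> 1 - r <= complex.Re u -> 1 - r <= complex.Re v ->
  cmod (base n u - base n v) <= 8 / (n%:R * (n%:R + 1)) / (1 - r) ^+ 2 * cmod (u - v).
Proof.
move=> r1 ur vr; have r0 : 0 < 1 - r by rewrite subr_gt0.
have u0 : 0 < complex.Re u by exact: lt_le_trans ur.
have v0 : 0 < complex.Re v by exact: lt_le_trans vr.
rewrite sub_base// mulrC cmodM ler_wpM2r ?cmod_ge0//.
apply: (le_trans (@cmod_slope_sum_le (fun i => ((u + (2^-1 ^+ i.+1)%:C) * (v + (2^-1 ^+ i.+1)%:C))^-1)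
  (fun i => 2^-1 ^+ i.+1 / (1 - r) ^+ 2) _)).
  move=> i ni; rewrite ler_wpM2l ?exprn_ge0// cmodV cmodM lef_pV2 ?posrE//.
  - rewrite expr2 ler_pM// ?(ltW r0)//.
      by have [_ _] := le_cmod_addR u0 (ltW (half_expn_gt0 R i.+1)); exact: le_trans.
    by have [_ _] := le_cmod_addR v0 (ltW (half_expn_gt0 R i.+1)); exact: le_trans.
  - by rewrite mulr_gt0// cmod_gt0 addR_neq0// ltW// half_expn_gt0.
  - by rewrite exprn_gt0.
under eq_bigr do rewrite mulrA.
rewrite -mulr_suml mulrA ler_wpM2r ?invr_ge0 ?exprn_ge0 ?(ltW r0)//.
rewrite (_ : 8 / _ = 4 / (n%:R * (n%:R + 1)) * 2); last by ring.
by rewrite ler_wpM2l ?sum_succ_half// divr_ge0// mulr_ge0// addr_ge0.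
Qed.

(** The modulus of u + 2^-i is at least both 2^-i and |u|, which gives the two bounds of
    [sum_succ_geometric]; the case [s = n] relies on the first alone. *)
Lemma cmod_base_slope_le u s : 0 < complex.Re u -> (s <= n)%N ->
  s = n \/ 2^-1 ^+ s <= cmod u ->
  cmod (base_slope n u u) <= 4 / (n%:R * (n%:R + 1)) * (2 ^+ s * (3 * s%:R + 2)).
Proof.
move=> u0 sn su.
pose x i := 2^-1 ^+ i / cmod (u + (2^-1 ^+ i)%:C) ^+ 2.
apply: (le_trans (@cmod_slope_sum_le (fun i => ((u + (2^-1 ^+ i.+1)%:C) * (u + (2^-1 ^+ i.+1)%:C))^-1)
  (fun i => x i.+1) _)) => [i _|].
  by rewrite cmodV cmodM /x expr2.
rewrite ler_wpM2l ?divr_ge0 ?mulr_ge0 ?addr_ge0//.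
have nu i : 0 < cmod (u + (2^-1 ^+ i)%:C).
  by rewrite cmod_gt0 addR_neq0// ltW// half_expn_gt0.
have e i : 2 ^+ i * 2^-1 ^+ i = 1 :> R by rewrite -exprMn divff ?expr1n.
rewrite -(subnKC sn); apply: sum_succ_geometric => [i|].
  rewrite ler_pdivrMr ?exprn_gt0//.
  rewrite [X in X <= _](_ : _ = 2 ^+ i * (2^-1 ^+ i) ^+ 2); last by rewrite expr2 mulrA e mul1r.
  rewrite ler_wpM2l ?exprn_ge0//.
  rewrite ler_sqr ?nnegrE ?exprn_ge0 ?cmod_ge0//.
  by have [_ ] := le_cmod_addR u0 (ltW (half_expn_gt0 R i)).
rewrite subn_gt0 => lsn i.
have us : 2^-1 ^+ s <= cmod u by case: su => // sE; rewrite sE ltnn in lsn.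
rewrite /x mulrC ler_wpM2r ?exprn_ge0// -[4 ^+ s]invrK lef_pV2 ?posrE ?exprn_gt0 ?invr_gt0//.
rewrite (_ : _^-1 = (2^-1 ^+ s) ^+ 2).
  rewrite ler_sqr ?nnegrE ?exprn_ge0 ?cmod_ge0//.
  by have [+ _ _] := le_cmod_addR u0 (ltW (half_expn_gt0 R i)); exact: le_trans.
by rewrite exprAC -exprVn; congr (_ ^+ _); field.
Qed.

(** If 2^-i >= 8 * 2^-s, the numerator is at most 3 * 2^-s and the quotient at most 1/2. These i <=
    k = s - 3 carry total weight k(k+1) / (n(n+1)), half of which is lost. For s <= 3 the truncated
    difference is 0 and the bound reads 1. *)
Lemma cmod_base_le_scale u s : 0 < complex.Re u -> (s <= n)%N -> cmod u < 2 * 2^-1 ^+ s ->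
  cmod (base n u) <= 1 - (s - 3)%:R * ((s - 3)%:R + 1) / (2 * (n%:R * (n%:R + 1))).
Proof.
move=> u0 sn us; pose k := (s - 3)%N.
have kn : (k <= n)%N by rewrite /k; lia.
pose rho i : R := if (i < k)%N then 2^-1 else 1.
apply: (le_trans (@cmod_base_le u rho u0 _)) => [i ni|].
  rewrite /rho; case: ifPn => ik; last first.
    by rewrite mul1r cmod_subR_le// ?half_expn_le// ltW// half_expn_gt0.
  have [_ h _] := le_cmod_addR u0 (ltW (half_expn_gt0 R i.+1)).
  have h1 : cmod (u - (2^-1 ^+ n)%:C) <= cmod u + 2^-1 ^+ n.
    by apply: (le_trans (cmodD _ _)); rewrite cmodN cmodR ger0_norm// exprn_ge0.
  have h2 := half_expn_le R sn.
  have h3 : 8 * 2^-1 ^+ s <= 2^-1 ^+ i.+1 :> R.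
    have /half_expn_le : (i.+1 <= s - 3)%N by [].
    move=> /(_ R); apply: le_trans.
    have s3 : (3 <= s)%N by move: ik; rewrite /k; lia.
    by rewrite -{1}(subnK s3) exprD; have := half_expn_gt0 R (s - 3); lra.
  have := half_expn_gt0 R s; move: h h1 h2 h3 us.
  move: (2^-1 ^+ s) (2^-1 ^+ n) (2^-1 ^+ i.+1) (cmod u) => A B C D; lra.
have -> : \sum_(i < n) weight n i.+1 * rho i = 1 - 2^-1 * \sum_(i < k) weight n i.+1.
  have := sum_halved_head (fun i => weight n i.+1) k (n - k).
  by rewrite subnKC// sum_weight => <-; apply: eq_bigr.
rewrite /weight -mulr_suml -mulr_sumr sum_succ -/k.
by rewrite le_eqVlt; apply/orP; left; apply/eqP; field; rewrite natr1 !pnatr_eq0 -!lt0n n_gt0.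
Qed.

End BaseFunction.

(** * Powers of the base function, rotated to a boundary point *)

Section Block.
Variable R : realType.
Implicit Types (z zeta : R[i]).

(** The dyadic scale of [a], with all sizes below 2^-n lumped into [s = n]. *)
Lemma scale_unitP (a : R) n : 0 <= a -> a < 2 -> exists s, [/\ (s <= n)%N,
  a < 2 * 2^-1 ^+ s & s = n \/ 2^-1 ^+ s <= a].
Proof.
move=> a0 a2; elim: n => [|n [s [sn sa [sE|sE]]]].
- by exists 0%N; split=> //; [rewrite expr0 mulr1|left].
- have [h|h] := ltP a (2^-1 ^+ n).
    by exists n.+1; split=> //; [rewrite exprS mulrA mulfV ?mul1r|left].
  by exists n; split=> //; [rewrite -sE|right].
- by exists s; split; [exact: leqW|exact: sa|right].
Qed.

(** Slope against decay of the power. With denominators cleared, (3s+2)(m+s+1) must be at most a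
    multiple of n + 1 plus a square in s - 3; the mixed term m s is absorbed by m^2 + s^2, which is
    why [n] is a square. The constant is 3600 = 15 * 4 * 60. *)
Lemma scale_quotient_le (m n s : nat) : (0 < m)%N -> n = (m ^ 2)%N ->
  15 * n%:R * (4 / (n%:R * (n%:R + 1)) * (2 ^+ s * (3 * s%:R + 2))) <=
  3600 * 2 ^+ s / (m + s.+1)%:R *
  (1 + n%:R * ((s - 3)%:R * ((s - 3)%:R + 1) / (2 * (n%:R * (n%:R + 1))))) :> R.
Proof.
move=> m0 nE; have n0 : 0 < n%:R :> R by rewrite ltr0n nE expn_gt0 m0.
have key : ((3 * s + 2) * (m + s.+1) * 2 <= 60 * (2 * (n + 1) + (s - 3) * (s - 3 + 1)))%N.
  rewrite nE; have [s3|s3] := leqP s 3.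
    have -> : (s - 3 = 0)%N by lia.
    have : ((3 * s + 2) * (m + s.+1) <= 11 * (m + 4))%N by apply: leq_mul; lia.
    nia.
  have [k ->] : exists k, s = (k + 3)%N by exists (s - 3)%N; lia.
  rewrite addnK; nia.
clear nE.
have -> : 15 * n%:R * (4 / (n%:R * (n%:R + 1)) * (2 ^+ s * (3 * s%:R + 2))) =
    60 * 2 ^+ s / (n%:R + 1) * (3 * s%:R + 2) :> R by field; lra.
have ms0 : 0 < (m + s.+1)%:R :> R by rewrite ltr0n; lia.
have k0 : 0 <= (s - 3)%:R :> R by [].
have -> : 3600 * 2 ^+ s / (m + s.+1)%:R *
    (1 + n%:R * ((s - 3)%:R * ((s - 3)%:R + 1) / (2 * (n%:R * (n%:R + 1))))) =
   60 * 2 ^+ s / (n%:R + 1) * (60 * (n%:R + 1 + (s - 3)%:R * ((s - 3)%:R + 1) / 2) / (m + s.+1)%:R) :> R.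
  field; apply/and3P; split; lra.
apply: ler_wpM2l; first by rewrite !mulr_ge0 ?invr_ge0 ?exprn_ge0// addr_ge0 ?ltW.
rewrite ler_pdivlMr//.
move: key; rewrite -(ler_nat R) !(natrM, natrD)  -(natr1 s) => key; lra.
Qed.

(** As 15 n - 1 >= n, the power is at most (1 - x)^n with [x] the loss at scale [s], and
    [bernoulli_inv] applies. *)
Lemma base_pow_le (n s : nat) (u : R[i]) : (0 < n)%N -> 0 < complex.Re u -> (s <= n)%N ->
  cmod u < 2 * 2^-1 ^+ s ->
  cmod (base n u) ^+ (15 * n).-1 *
    (1 + n%:R * ((s - 3)%:R * ((s - 3)%:R + 1) / (2 * (n%:R * (n%:R + 1))))) <= 1.
Proof.
move=> n0 u0 sn us; have := cmod_base_le_scale n0 u0 sn us.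
have b0 := cmod_ge0 (base n u); have b1 := cmod_base_le1 n0 u0.
set x := _ / _ => bx.
have x0 : 0 <= x by rewrite /x divr_ge0// !mulr_ge0// addr_ge0.
have x1 : x <= 1 by lra.
apply: le_trans (bernoulli_inv n x0 x1).
apply: ler_wpM2r; first by rewrite addr_ge0// mulr_ge0.
apply: (@le_trans _ _ (cmod (base n u) ^+ n)).
  by apply: ler_wiXn2l => //; lia.
by rewrite lerXn2r// nnegrE; lra.
Qed.

(** At n = 16^j the exponent is 16^(j+1) - 16^j, so the blocks of zeros tile the indices. The zero
    is at (1 - 2^-n) zeta. *)
Definition block (n : nat) zeta z : R[i] := base n (1 - z / zeta) ^+ (15 * n).

Lemma is_derive_affine (a k z : R[i]) : is_derive z (1 : R[i]) (fun y => a - y * k) (- k).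
Proof.
apply/is_derive_epsP => e e0; exists 1 => // y _.
rewrite (_ : _ - _ - _ = 0); last by ring.
by rewrite cmod0 mulr_ge0 ?cmod_ge0// ltW.
Qed.

Lemma is_derive_moebius (a b k z : R[i]) : 1 - z * k + b != 0 ->
  is_derive z (1 : R[i]) (fun y => (1 - y * k - a) / (1 - y * k + b))
    (- k * ((b + a) / ((1 - z * k + b) * (1 - z * k + b)))).
Proof.
move=> zb; pose f y := (1 - a) - y * k; pose g y := (1 + b) - y * k.
have gz : g z != 0 by rewrite /g addrAC.
have hf : is_derive z (1 : R[i]) f (- k) := is_derive_affine _ _ _.
have hg : is_derive z (1 : R[i]) g (- k) := is_derive_affine _ _ _.
have hgi : is_derive z (1 : R[i]) (fun y => (g y)^-1) (k / (g z) ^+ 2).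
  have [dg dgE] := hg.
  apply: (DeriveDef (derivableV gz dg)).
  rewrite (deriveV gz dg) dgE.
  by rewrite scale_selfE; field.
rewrite (_ : (fun y => _) = f * (fun y => (g y)^-1)); last first.
  apply/funext => y; transitivity (f y * (g y)^-1) => //.
  by rewrite /f /g; congr (_ * _^-1); ring.
apply: (is_derive_eq (is_deriveM hf hgi)).
rewrite !scale_selfE.
have -> : 1 - z * k + b = g z by rewrite /g; ring.
have fg : f z = g z - (b + a) by rewrite /f /g; ring.
by rewrite fg; field.
Qed.

Section Zeta.
Variables (n : nat) (zeta : R[i]).
Hypotheses (n_gt0 : (0 < n)%N) (zeta1 : cmod zeta = 1).

Lemma Re_rotated_ge z (r : R) : cmod z <= r -> 1 - r <= complex.Re (1 - z / zeta).
Proof.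
move=> zr; have : cmod (z / zeta) <= r by rewrite cmodM cmodV zeta1 invr1 mulr1.
have := le_Re_cmod (z / zeta); case: (z / zeta) => a b /=.
by move=> h1 h2; have := ler_norm a; lra.
Qed.

Lemma Re_rotated_gt0 z : disc z -> 0 < complex.Re (1 - z / zeta).
Proof.
by move=> z1; apply: lt_le_trans (Re_rotated_ge (lexx _)); rewrite subr_gt0.
Qed.

Lemma zeta_neq0 : zeta != 0.
Proof. by rewrite -cmod_eq0 zeta1 oner_eq0. Qed.

Lemma cmod_rotated z : cmod (1 - z / zeta) = cmod (z - zeta).
Proof.
rewrite -[LHS]mulr1 -[X in _ * X = _]zeta1 -cmodM mulrBl mul1r divfK ?zeta_neq0//.
by rewrite cmodB.
Qed.

Lemma block_le1 z : disc z -> cmod (block n zeta z) <= 1.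
Proof.
move=> z1; rewrite /block cmodX exprn_ile1 ?cmod_ge0//.
by rewrite cmod_base_le1// Re_rotated_gt0.
Qed.

Lemma block_derive z : disc z -> exists2 d, is_derive z (1 : R[i]) (block n zeta) d &
  cmod d = (15 * n)%:R * cmod (base n (1 - z / zeta)) ^+ (15 * n).-1 *
    cmod (base_slope n (1 - z / zeta) (1 - z / zeta)).
Proof.
move=> z1; have u0 := Re_rotated_gt0 z1.
pose t (i : 'I_n) y : R[i] := (weight R n i.+1)%:C *
    ((1 - y / zeta - (2^-1 ^+ n)%:C) / (1 - y / zeta + (2^-1 ^+ i.+1)%:C)).
pose dt (i : 'I_n) : R[i] := (weight R n i.+1)%:C * (- zeta^-1 * (((2^-1 ^+ i.+1)%:C + (2^-1 ^+ n)%:C) /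
   ((1 - z / zeta + (2^-1 ^+ i.+1)%:C) * (1 - z / zeta + (2^-1 ^+ i.+1)%:C)))).
have ht i : is_derive z (1 : R[i]) (t i) (dt i).
  apply: is_deriveZ; apply: is_derive_moebius.
  by rewrite addR_neq0// ltW// half_expn_gt0.
have hs : is_derive z (1 : R[i]) (fun y => base n (1 - y / zeta))
    (- zeta^-1 * base_slope n (1 - z / zeta) (1 - z / zeta)).
  rewrite (_ : (fun y => _) = \sum_(i < n) t i); last first.
    by apply/funext => y; rewrite fct_sumE.
  apply: is_derive_eq; rewrite /base_slope mulr_sumr; apply: eq_bigr => i _.
  by rewrite /dt rmorphD mulrCA.
have hX := is_deriveX (15 * n) hs.
eexists.
  rewrite (_ : block n zeta = (fun y => base n (1 - y / zeta)) ^+ (15 * n)); first exact: hX.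
  by apply/funext => y; rewrite /block; elim: (15 * n)%N => [|k IH]//; rewrite !exprS IH.
rewrite scale_selfE !cmodM cmodN cmodV zeta1 invr1 mul1r cmodX; congr (_ * _ * _).
by rewrite -(rmorph_nat (@real_complex_def _ (Phant R))) cmodR ger0_norm.
Qed.

(** The power of [base] is at most 1 / [Q], while 15 n times the slope is at most [Q] times the
    claimed bound. *)
Lemma block_derive_le z d m s : disc z -> n = (m ^ 2)%N -> (0 < m)%N ->
  is_derive z (1 : R[i]) (block n zeta) d ->
  (s <= n)%N -> cmod (z - zeta) < 2 * 2^-1 ^+ s -> s = n \/ 2^-1 ^+ s <= cmod (z - zeta) ->
  cmod d <= 3600 * 2 ^+ s / (m + s.+1)%:R.
Proof.
move=> z1 nE m0 dP sn zs sz.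
have [d' d'P] := block_derive z1.
have <- : d' = d by have [_ <-] := d'P; have [_ <-] := dP.
move=> ->; have u0 := Re_rotated_gt0 z1; rewrite -cmod_rotated in zs sz.
have h1 := cmod_base_slope_le u0 sn sz.
have h2 := base_pow_le n_gt0 u0 sn zs.
have h3 := @scale_quotient_le m n s m0 nE.
set Q := (1 + n%:R * _) in h2 h3.
have Q0 : 1 <= Q.
  by rewrite lerDl mulr_ge0// divr_ge0 ?mulr_ge0 ?addr_ge0 ?mulr_ge0 ?addr_ge0.
rewrite -(ler_pM2r (lt_le_trans ltr01 Q0)); apply: le_trans h3.
rewrite natrM; set P := _ ^+ (15 * n).-1 in h2 *; set S := cmod (base_slope _ _ _) in h1 *.
rewrite (_ : 15%:R * n%:R * P * S * Q = 15 * n%:R * ((P * Q) * S)); last by ring.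
rewrite ler_wpM2l ?mulr_ge0//; apply: le_trans h1.
by rewrite ler_piMl// cmod_ge0.
Qed.

(** The term at the scale of [z] already dominates and the others are nonnegative. Summing over all
    scales removes the choice of [s] and leaves multiples of indicators of discs. *)
Lemma block_energy_density z d m : disc z -> n = (m ^ 2)%N -> (0 < m)%N ->
  is_derive z (1 : R[i]) (block n zeta) d ->
  cmod d ^+ 2 <= \sum_(s < n.+1) 3600 ^+ 2 * 4 ^+ s / (m + s.+1)%:R ^+ 2 *
     (cmod (z - zeta) < 2 * 2^-1 ^+ s)%R%:R.
Proof.
move=> z1 nE m0 dP.
have z2 : cmod (z - zeta) < 2.
  by apply: (le_lt_trans (cmodD _ _)); rewrite cmodN zeta1; have : cmod z < 1 := z1; lra.
have [s [sn zs sz]] := @scale_unitP _ n (cmod_ge0 _) z2.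
have sn1 : (s < n.+1)%N by [].
have := block_derive_le z1 nE m0 dP sn zs sz.
have : 0 <= 3600 :> R by rewrite ler0n.
move: (3600 : R) => K K0 dK.
rewrite (bigD1 (Ordinal sn1))//= zs mulr1 -[X in X <= _]addr0 lerD//; last first.
  apply: sumr_ge0 => i _; rewrite mulr_ge0//.
  by rewrite divr_ge0 ?exprn_ge0// mulr_ge0 ?exprn_ge0.
have -> : K ^+ 2 * 4 ^+ s / (m + s.+1)%:R ^+ 2 = (K * 2 ^+ s / (m + s.+1)%:R) ^+ 2 :> R.
  have -> : 4 ^+ s = (2 ^+ s) ^+ 2 :> R by rewrite exprAC; congr (_ ^+ _); ring.
  by rewrite !exprMn exprVn.
by rewrite ler_sqr ?nnegrE ?cmod_ge0// (le_trans (cmod_ge0 d)).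
Qed.

Lemma cmod_expB_le (a b : R[i]) M : cmod a <= 1 -> cmod b <= 1 ->
  cmod (a ^+ M - b ^+ M) <= M%:R * cmod (a - b).
Proof.
move=> a1 b1; have := @cmod_prodB_le R (fun=> a) (fun=> b) M (fun=> a1) (fun=> b1).
by rewrite !prodr_const !card_ord sumr_const card_ord mulr_natl.
Qed.

(** The n^-2 estimates for [base] lose the exponent 15 n, whence 120 = 15 * 8 and an order 1/n,
    summable over n = 16^j. *)
Lemma block_tame (r : R) y z : r < 1 -> cmod y <= r -> cmod z <= r ->
  cmod (block n zeta z - 1) <= 120 / (1 - r) ^+ 2 / n%:R /\
  cmod (block n zeta y - block n zeta z) <= 120 / (1 - r) ^+ 2 / n%:R * cmod (y - z).
Proof.
move=> r1 yr zr; have r0 : 0 < 1 - r by rewrite subr_gt0.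
have uy := Re_rotated_ge yr; have uz := Re_rotated_ge zr.
have n0 : 0 < n%:R :> R by rewrite ltr0n.
have by1 := cmod_base_le1 n_gt0 (lt_le_trans r0 uy).
have bz1 := cmod_base_le1 n_gt0 (lt_le_trans r0 uz).
have rr : r >= 0 by apply: le_trans yr; exact: cmod_ge0.
split.
  rewrite /block -[X in _ - X](expr1n _ (15 * n)%N).
  apply: (le_trans (cmod_expB_le _ bz1 _)); first by rewrite cmod1.
  have h := cmod_sub1_base_le n_gt0 r1 uz.
  apply: (@le_trans _ _ ((15 * n)%:R * (8 / (n%:R * (n%:R + 1)) / (1 - r)))).
    by rewrite ler_wpM2l.
  rewrite (_ : (15 * n)%:R * _ = 120 / (1 - r) * (n%:R + 1)^-1); last first.
    by rewrite natrM; field; lra.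
  rewrite ler_pM ?invr_ge0 ?mulr_ge0 ?invr_ge0 ?(ltW r0) ?addr_ge0//.
    rewrite ler_wpM2l// lef_pV2 ?posrE ?exprn_gt0//.
    rewrite expr2 ler_piMl ?(ltW r0)//; lra.
  by rewrite lef_pV2 ?posrE//; lra.
rewrite /block; apply: (le_trans (cmod_expB_le _ by1 bz1)).
have := cmod_sub_base_le n r1 uy uz.
rewrite (_ : 1 - y / zeta - (1 - z / zeta) = (z - y) / zeta); last by ring.
rewrite cmodM cmodV zeta1 invr1 mulr1 (cmodB z) => h.
apply: (@le_trans _ _ ((15 * n)%:R * (8 / (n%:R * (n%:R + 1)) / (1 - r) ^+ 2 * cmod (y - z)))).
  by rewrite ler_wpM2l.
rewrite mulrA ler_wpM2r ?cmod_ge0//.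
rewrite (_ : (15 * n)%:R * _ = 120 / (1 - r) ^+ 2 * (n%:R + 1)^-1); last first.
  by rewrite natrM; field; lra.
rewrite ler_wpM2l ?divr_ge0 ?exprn_ge0 ?(ltW r0)//.
by rewrite lef_pV2 ?posrE//; lra.
Qed.

End Zeta.
End Block.

(** * Integrals over the disc *)

Section IntegralBounds.
Local Open Scope ereal_scope.

(* The integral of a nonnegative function is a supremum over simple functions,
   hence monotone without measurability. *)
Lemma nneg_le_integral (d : measure_display) (T : measurableType d) (R : realType)
    (mu : {measure set T -> \bar R}) (D : set T) (f g : T -> \bar R) :
  (forall x, D x -> 0 <= f x) -> (forall x, 0 <= g x) -> (forall x, D x -> f x <= g x) ->
  \int[mu]_(x in D) f x <= \int[mu]_x g x.
Proof.
move=> f0 g0 fg; rewrite integral_mkcond.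
have fD0 x : 0 <= (f \_ D) x by rewrite /patch; case: ifPn => // /set_mem; exact: f0.
rewrite !ge0_integralTE//; apply: le_ereal_sup => _ [h hf <-]; exists h => // x.
apply: (le_trans (hf x)); rewrite /patch; case: ifPn => [/set_mem|_]; [exact: fg|exact: g0].
Qed.

Lemma nneseries_le (R : realType) (u : nat -> \bar R) (M : \bar R) :
  (forall i, 0 <= u i) -> (forall n, \sum_(i < n) u i <= M) -> \sum_(i <oo) u i <= M.
Proof.
move=> u0 uM; apply: lime_le; first by apply: is_cvg_nneseries.
by apply: nearW => n; rewrite big_mkord.
Qed.

Lemma integral_series_indic (d : measure_display) (T : measurableType d) (R : realType)
    (mu : {measure set T -> \bar R}) (N : nat -> nat) (c : nat -> nat -> R) (A : nat -> nat -> set T) :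
  (forall j s, 0 <= c j s)%R -> (forall j s, measurable (A j s)) ->
  \int[mu]_x (\sum_(j <oo) \sum_(s < N j) (c j s * \1_(A j s) x)%:E) =
  \sum_(j <oo) \sum_(s < N j) (c j s)%:E * mu (A j s).
Proof.
move=> c0 mA.
have f0 j s x : 0 <= (c j s * \1_(A j s) x)%:E by rewrite lee_fin mulr_ge0.
have mf j s : measurable_fun [set: T] (fun x => (c j s * \1_(A j s) x)%:E : \bar R).
  by apply/measurable_EFinP; apply: measurable_funM => //; exact: measurable_indic.
rewrite integral_nneseries//; last first.
- by move=> j x _; apply: sume_ge0.
- by move=> j; apply: emeasurable_sum.
apply: eq_eseriesr => j _; rewrite ge0_integral_sum//; apply: eq_bigr => s _.
rewrite (@integralZl_indic _ _ _ mu setT measurableT (fun=> A j s) (c j s))//.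
  by rewrite integral_indic// setIT.
by move=> cn; have := c0 j s; rewrite leNgt cn.
Qed.

End IntegralBounds.

Section Square.
Variable R : realType.

(** Squares enclosing the discs of radius [r], chosen because their product measure is immediate. *)
Definition square (z : R[i]) (r : R) : set (R * R) :=
  `]complex.Re z - r, complex.Re z + r[%classic `*` `]complex.Im z - r, complex.Im z + r[%classic.

Lemma measurable_square (z : R[i]) (r : R) : measurable (square z r).
Proof. by apply: measurableX; exact: measurable_itv. Qed.

Lemma measure_square (z : R[i]) (r : R) : 0 < r ->
  (@lebesgue_measure R \x @lebesgue_measure R)%E (square z r) = (4 * r ^+ 2)%:E.
Proof.
move=> r0; rewrite /square product_measure1E; [|exact: measurable_itv|exact: measurable_itv].
have lE (a : R) : lebesgue_measure (`]a - r, a + r[%classic : set R) = (2 * r)%:E.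
  rewrite lebesgue_measure_itv /= lte_fin ifT; last lra.
  by rewrite -EFinD; congr _%:E; ring.
transitivity ((2 * r)%:E * (2 * r)%:E)%E; last by rewrite -EFinM; congr _%:E; ring.
by congr (_ * _)%E; exact: lE.
Qed.

Lemma square_near (z : R[i]) (r : R) (p : R * R) :
  cmod (p.1 +i* p.2 - z) < r -> square z r p.
Proof.
move=> h; set w := _ - z in h.
have : `|complex.Re w| < r := le_lt_trans (le_Re_cmod w) h.
have : `|complex.Im w| < r := le_lt_trans (le_Im_cmod w) h.
rewrite /w; case: p z {h w} => x y [a b]; rewrite /= !ltr_norml => h1 h2.
by split; rewrite /= in_itv /=; lra.
Qed.

End Square.

(** Weighted Cauchy-Schwarz: the weights 2^-(i+1) sum to less than 1. The price 2^(j+1) is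
    affordable, the energy of block j being of order 4^-j. *)
Lemma sqr_sum_le (R : realFieldType) (x : nat -> R) J :
  (\sum_(i < J) x i) ^+ 2 <= \sum_(i < J) 2 ^+ i.+1 * x i ^+ 2.
Proof.
elim: J x => [|J IH] x; first by rewrite !big_ord0 expr0n.
rewrite !big_ord_recl /= expr1.
have := IH (fun i => x i.+1).
rewrite [X in _ -> _ <= _ + X](_ : _ = 2 * \sum_(i < J) 2 ^+ i.+1 * x i.+1 ^+ 2); last first.
  by rewrite mulr_sumr; apply: eq_bigr => i _; rewrite exprS mulrA.
move: (\sum_(i < J) x i.+1) (\sum_(i < J) 2 ^+ i.+1 * x i.+1 ^+ 2) (x 0%N).
move=> a b c; have := sqr_ge0 (a - c); nra.
Qed.

(** * The product and its zeros *)

Section DirichletProduct.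
Variables (R : realType) (zeta : nat -> R[i]).
Hypothesis zeta1 : forall j, cmod (zeta j) = 1.

Definition block_factor j : R[i] -> R[i] := block (16 ^ j) (zeta j).

Definition block_node j : R[i] := (1 - 2^-1 ^+ (16 ^ j))%:C * zeta j.

(* Block j has 15 * 16^j terms, so it starts at index 16^j - 1. *)
Definition block_index k := trunc_log 16 k.+1.

Lemma expn16_gt0 j : (0 < 16 ^ j)%N.
Proof. by rewrite expn_gt0. Qed.

Lemma tame_factor : tame_factors block_factor.
Proof.
split=> [j z z1|j z z1|r r1].
- exact: (block_le1 (expn16_gt0 j) (zeta1 j)).
- by have [d [+ _] _] := block_derive (16 ^ j) (zeta1 j) z1.
exists (120 / (1 - r) ^+ 2); first by rewrite divr_ge0// exprn_ge0// subr_ge0 ltW.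
move=> j y z yr zr.
have [h1 h2] := block_tame (expn16_gt0 j) (zeta1 j) r1 yr zr.
have le2 : 120 / (1 - r) ^+ 2 / (16 ^ j)%:R <= 120 / (1 - r) ^+ 2 * 2^-1 ^+ j.
  rewrite ler_wpM2l ?divr_ge0 ?exprn_ge0 ?subr_ge0 ?(ltW r1)//.
  rewrite natrX -exprVn lerXn2r ?nnegrE ?invr_ge0//.
  by rewrite lef_pV2 ?posrE// ler_nat.
split; first exact: le_trans le2.
by apply: (le_trans h2); rewrite ler_wpM2r ?cmod_ge0.
Qed.

(** The factor 2^(j+1) comes from [sqr_sum_le], the rest from [block_energy_density] with m = 4^j,
    the square root of 16^j. The resulting [density] is an explicit majorant of |f'|^2 on the
    disc. *)
Definition density_coef (j s : nat) : R :=
  2 ^+ j.+1 * (3600 ^+ 2 * 4 ^+ s / (4 ^ j + s.+1)%:R ^+ 2).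

Definition density (p : R * R) : \bar R :=
  (\sum_(j <oo) \sum_(s < (16 ^ j).+1)
    (density_coef j s * \1_(square (zeta j) (2 * 2^-1 ^+ s)) p)%:E)%E.

Lemma density_coef_ge0 j s : 0 <= density_coef j s.
Proof.
have K0 : 0 <= 3600 :> R by rewrite ler0n.
rewrite /density_coef; move: (3600 : R) K0 => K K0.
by rewrite mulr_ge0 ?exprn_ge0// divr_ge0 ?exprn_ge0// mulr_ge0 ?exprn_ge0.
Qed.

(** The area 16 * 4^-s of a square cancels 4^s; the remaining inverse squares sum to at most 4^-j,
    so block j contributes at most 32 * 3600^2 * 2^-j. *)
Lemma integral_density : (\int[lebesgue_measure \x lebesgue_measure]_p density p < +oo)%E.
Proof.
have /= mE := @integral_series_indic _ _ R (lebesgue_measure \x lebesgue_measure)%E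
  (fun j => (16 ^ j).+1) density_coef (fun j s => square (zeta j) (2 * 2^-1 ^+ s))
  density_coef_ge0 (fun j s => measurable_square (zeta j) _).
rewrite /density {}mE.
have K0 : 0 <= 3600 :> R by rewrite ler0n.
apply: (@le_lt_trans _ _ (2 * (32 * 3600 ^+ 2))%:E); last by rewrite ltry.
rewrite /density_coef; move: (3600 : R) K0 => K K0.
have t0 j s : (0 <= (2 ^+ j.+1 * (K ^+ 2 * 4 ^+ s / (4 ^ j + s.+1)%:R ^+ 2))%:E *
    (lebesgue_measure \x lebesgue_measure) (square (zeta j) (2 * 2^-1 ^+ s)))%E.
  rewrite mule_ge0// lee_fin mulr_ge0 ?exprn_ge0// divr_ge0 ?exprn_ge0// mulr_ge0 ?exprn_ge0//.
apply: nneseries_le => [j|J]; first by apply: sume_ge0 => s _; exact: t0.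
suff le1 j : (\sum_(s < (16 ^ j).+1) (2 ^+ j.+1 * (K ^+ 2 * 4 ^+ s / (4 ^ j + s.+1)%:R ^+ 2))%:E *
    (lebesgue_measure \x lebesgue_measure) (square (zeta j) (2 * 2^-1 ^+ s)) <=
    (32 * K ^+ 2 * 2^-1 ^+ j)%:E)%E.
  apply: (@le_trans _ _ (\sum_(j < J) (32 * K ^+ 2 * 2^-1 ^+ j)%:E)%E).
    by apply: lee_sum => j _; exact: le1.
  rewrite sumEFin lee_fin; apply: (@sum_half_le2 R (fun i => 32 * K ^+ 2 * 2^-1 ^+ i)) => //.
  by rewrite mulr_ge0// exprn_ge0.
under eq_bigr do rewrite measure_square ?mulr_gt0 ?half_expn_gt0// -EFinM.
rewrite sumEFin lee_fin.
rewrite (eq_bigr (fun s : 'I_(16 ^ j).+1 => 2 ^+ j.+1 * K ^+ 2 * 16 * ((4 ^ j + s.+1)%:R ^+ 2)^-1)); last first.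
  move=> s _; have e : 4 ^+ s * (2^-1 ^+ s) ^+ 2 = 1 :> R.
    by rewrite exprAC -exprMn (_ : 4 * 2^-1 ^+ 2 = 1) ?expr1n//; field.
  transitivity (2 ^+ j.+1 * K ^+ 2 * 16 * ((4 ^ j + s.+1)%:R ^+ 2)^-1 * (4 ^+ s * (2^-1 ^+ s) ^+ 2)).
    by ring.
  by rewrite e mulr1.
rewrite -mulr_sumr.
apply: (@le_trans _ _ (2 ^+ j.+1 * K ^+ 2 * 16 * (4 ^ j)%:R^-1)).
  by rewrite ler_wpM2l ?mulr_ge0 ?exprn_ge0// sum_inv_sqr// expn_gt0.
rewrite le_eqVlt; apply/orP; left; apply/eqP.
have -> : (4 ^ j)%:R^-1 = 2^-1 ^+ j * 2^-1 ^+ j :> R.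
  by rewrite natrX -exprVn -exprMn; congr (_ ^+ _); field.
have e : 2 ^+ j * 2^-1 ^+ j = 1 :> R by rewrite -exprMn divff ?expr1n.
transitivity (32 * K ^+ 2 * 2^-1 ^+ j * (2 ^+ j * 2^-1 ^+ j)); last by rewrite e mulr1.
by rewrite exprS; ring.
Qed.

Lemma infprod_factor_density (p : R * R) : disc (p.1 +i* p.2) ->
  ((cmod ((infprod block_factor)^`()%classic (p.1 +i* p.2)) ^+ 2)%:E <= density p)%E.
Proof.
set z := p.1 +i* p.2 => z1.
pose dh j := 'D_1 (block_factor j) z.
have hd j : is_derive z (1 : R[i]) (block_factor j) (dh j).
  by apply: derivableP; have [_ + _] := tame_factor; apply.
have [d dP [dG [B dGB] dGle]] := infprod_derive tame_factor z1 hd.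
have -> : (infprod block_factor)^`()%classic z = d by rewrite derive1E; case: dP.
have t0 j s : (0 <= (density_coef j s * \1_(square (zeta j) (2 * 2^-1 ^+ s)) p)%:E)%E.
  by rewrite lee_fin mulr_ge0// density_coef_ge0.
have D0 : (0 <= density p)%E by apply: nneseries_ge0 => j _ _; apply: sume_ge0.
have dGD J : ((cmod (dG J) ^+ 2)%:E <= density p)%E.
  apply: (@le_trans _ _ (\sum_(j < J) 2 ^+ j.+1 * cmod (dh j) ^+ 2)%:E).
    rewrite lee_fin; apply: le_trans (sqr_sum_le (fun j => cmod (dh j)) J).
    by rewrite ler_sqr ?nnegrE ?cmod_ge0 ?sumr_ge0// => i _; exact: cmod_ge0.
  apply: (@le_trans _ _ (\sum_(0 <= j < J) \sum_(s < (16 ^ j).+1)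
      (density_coef j s * \1_(square (zeta j) (2 * 2^-1 ^+ s)) p)%:E)%E); last first.
    by apply: nneseries_lim_ge => j _ _; apply: sume_ge0.
  rewrite big_mkord -sumEFin; apply: lee_sum => j _.
  rewrite sumEFin lee_fin.
  have nE : (16 ^ j = (4 ^ j) ^ 2)%N by rewrite -expnM mulnC expnM.
  have := block_energy_density (expn16_gt0 j) (zeta1 j) z1 nE (_ : (0 < 4 ^ j)%N) (hd j).
  rewrite expn_gt0 => /(_ isT) h.
  have p0 : 0 <= 2 ^+ j.+1 :> R by rewrite exprn_ge0.
  apply: (le_trans (ler_wpM2l p0 h)); rewrite mulr_sumr; apply: ler_sum => s _.
  rewrite mulrA -/(density_coef j s) ler_wpM2l ?density_coef_ge0//.
  have [zs|_] := boolP (_ < _); last by rewrite indicE ler_nat.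
  by rewrite indicE mem_set//; exact: square_near.
(* An infinite density leaves nothing to prove; a finite one bounds every [dG J], and the bound
   survives the limit. *)
move: (density p) D0 dGD => [g| |]; rewrite ?leey ?leeNy_eq//= !lee_fin => g0 dGD.
have dGs J : cmod (dG J) <= Num.sqrt g.
  by have := dGD J; rewrite lee_fin -(ler_sqrt _ g0) sqrtr_sqr ger0_norm ?cmod_ge0.
rewrite -[leRHS]sqr_sqrtr// ler_sqr ?nnegrE ?cmod_ge0 ?sqrtr_ge0//.
apply/ler_addgt0Pr => e e0.
have [N /(_ N (leqnn N)) NP] := geometric_small B e0.
have := cmodD (d - dG N) (dG N); rewrite subrK cmodB.
have := dGB N; have := dGs N; lra.
Qed.

Lemma dirichlet_infprod_factor : dirichlet_space (infprod block_factor).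
Proof.
split; first exact: infprod_analytic tame_factor.
rewrite /dirichlet_integral.
have : (\int[lebesgue_measure \x lebesgue_measure]_(p in [set p : R * R | disc (p.1 +i* p.2)])
   (cmod ((infprod block_factor)^`()%classic (p.1 +i* p.2)) ^+ 2)%:E < +oo)%E.
  apply: le_lt_trans integral_density; apply: nneg_le_integral.
  - by move=> p _; rewrite lee_fin exprn_ge0// cmod_ge0.
  - move=> p; apply: nneseries_ge0 => j _ _; apply: sume_ge0 => s _.
    by rewrite lee_fin mulr_ge0// density_coef_ge0.
  - exact: infprod_factor_density.
by move=> h; rewrite lte_mul_pinfty// lee_fin invr_ge0 pi_ge0.
Qed.

End DirichletProduct.

(** * Grouping of the indices into blocks *)

Section BlockIndex.

Lemma block_indexP j k : (block_index k == j) = (16 ^ j <= k.+1 < 16 ^ j.+1)%N.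
Proof.
rewrite /block_index; apply/eqP/idP => [<-|jk]; last exact: trunc_log_eq.
by rewrite trunc_logP//= trunc_log_ltn.
Qed.

Lemma block_index_fiber j :
  [set k | block_index k = j] = [set ((16 ^ j).-1 + i)%N | i in `I_(15 * 16 ^ j)].
Proof.
have p := expn16_gt0 j; apply/seteqP; split=> [k /= /eqP|_ /= [i ij <-]].
  rewrite block_indexP expnS => kj; exists (k - (16 ^ j).-1)%N => /=; lia.
apply/eqP; rewrite block_indexP expnS; lia.
Qed.

Lemma card_block_index j : ([set k | block_index k = j] #= `I_(15 * 16 ^ j))%card.
Proof.
by rewrite block_index_fiber; apply: inj_card_eq => i i' _ _ /addnI.
Qed.

Lemma block_index_start j : block_index (16 ^ j).-1 = j.
Proof.
have p := expn16_gt0 j.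
by apply/eqP; rewrite block_indexP expnS; lia.
Qed.

End BlockIndex.

(** * Zeros of the product and their multiplicities *)

Section Zeros.
Variables (R : realType) (zeta : nat -> R[i]).
Hypothesis zeta1 : forall j, cmod (zeta j) = 1.
Local Notation node := (block_node zeta).
Local Notation factor := (block_factor zeta).

Lemma half_pow16_lt1 j : 2^-1 ^+ (16 ^ j) < 1 :> R.
Proof. by rewrite exprn_ilt1// ?invf_lt1// -?lt0n ?expn16_gt0//; lra. Qed.

Lemma cmod_node j : cmod (node j) = 1 - 2^-1 ^+ (16 ^ j).
Proof.
rewrite cmodM zeta1 mulr1 cmodR ger0_norm//.
by rewrite subr_ge0 ltW// half_pow16_lt1.
Qed.

Lemma node_inj : injective node.
Proof.
move=> i j /(congr1 (@cmod R)); rewrite !cmod_node => ij.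
have {}ij : 2^-1 ^+ (16 ^ i) = 2^-1 ^+ (16 ^ j) :> R by lra.
have h0 : 0 < 2^-1 :> R by [].
have h1 : 2^-1 != 1 :> R by lra.
by have /eqP := ieexprIn h0 h1 ij; rewrite eqn_exp2l// => /eqP.
Qed.

Lemma disc_node j : disc (node j).
Proof. by rewrite /disc /= cmod_node gtrBl half_expn_gt0. Qed.

Lemma node_neq0 j : node j != 0.
Proof. by rewrite -cmod_gt0 cmod_node subr_gt0 half_pow16_lt1. Qed.

Lemma node_direction j : node j / (cmod (node j))%:C = zeta j.
Proof.
rewrite cmod_node /block_node mulrAC divff ?mul1r//.
have -> : (0 : R[i]) = (0 : R)%:C by [].
rewrite (inj_eq (@complexI R)) subr_eq0 eq_sym; exact: negbT (lt_eqF (half_pow16_lt1 j)).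
Qed.

Lemma rotated_node j z : 1 - z / zeta j - (2^-1 ^+ (16 ^ j))%:C = (node j - z) / zeta j.
Proof.
by rewrite /block_node rmorphB /=; field; exact: zeta_neq0.
Qed.

Lemma factor_neq0 j z : disc z -> z != node j -> factor j z != 0.
Proof.
move=> z1 zj; rewrite /block_factor /block expf_neq0// base_neq0 ?expn16_gt0 ?Re_rotated_gt0//.
rewrite -subr_eq0 rotated_node mulf_neq0 ?invr_eq0 ?(zeta_neq0 (zeta1 j))//.
by rewrite subr_eq0 eq_sym.
Qed.

Lemma derivable_base_cofactor n j (z : R[i]) : disc z ->
  derivable (fun y : R[i] => base_cofactor n (1 - y / zeta j)) z 1.
Proof.
move=> z1; have u0 := Re_rotated_gt0 (zeta1 j) z1.
rewrite (_ : (fun y => _) = \sum_(i < n) (fun y => (weight R n i.+1)%:C *: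
    (1 - y / zeta j + (2^-1 ^+ i.+1)%:C)^-1)); last first.
  by apply/funext => y; rewrite fct_sumE.
apply: derivable_sum => i; apply: derivableZ; apply: derivableV.
  by rewrite addR_neq0// ltW// half_expn_gt0.
rewrite (_ : (fun y => _) = (fun y => (1 + (2^-1 ^+ i.+1)%:C) - y * (zeta j)^-1)).
  by have [] := is_derive_affine (1 + (2^-1 ^+ i.+1)%:C) (zeta j)^-1 z.
by apply/funext => y; rewrite addrAC.
Qed.

(** Factor [j] is a power of z - node times -1/zeta times the zero-free [base_cofactor]. The head
    and the tail of the product do not vanish at this node, as distinct nodes have distinct
    moduli. *)
Lemma infprod_factor_multiplicity j :
  zero_of_multiplicity (infprod factor) (15 * 16 ^ j) (node j).
Proof.
pose tail := infprod (fun i => factor (j.+1 + i)%N).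
pose g (z : R[i]) := \prod_(i < j) factor i z * ((- (zeta j)^-1) ^+ (15 * 16 ^ j) *
  base_cofactor (16 ^ j) (1 - z / zeta j) ^+ (15 * 16 ^ j)) * tail z.
have hT := tame_factor zeta1.
have z0 := zeta_neq0 (zeta1 j).
have Nf i : i != j -> factor i (node j) != 0.
  move=> ij; apply: factor_neq0; first exact: disc_node.
  by apply: contra_neq ij => /node_inj.
exists g; split.
- move=> z z1.
  have d1 : derivable (fun z => \prod_(i < j) factor i z) z 1.
    have [h1 hd _] := hT.
    by have [d [? _] _] := @prod_derive R factor (fun j => 'D_1 (factor j) z) z j z1
      (fun i => h1 i z z1) (fun i => derivableP (hd i z z1)).
  have d2 : derivable tail z 1 := (infprod_analytic (tame_factors_shift j.+1 hT) z1).
  have d3 : derivable (fun z => (- (zeta j)^-1) ^+ (15 * 16 ^ j) *: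
      (fun y => base_cofactor (16 ^ j) (1 - y / zeta j) ^+ (15 * 16 ^ j)) z) z 1.
    apply: derivableZ.
    rewrite (_ : (fun y => _) = (fun y => base_cofactor (16 ^ j) (1 - y / zeta j)) ^+ (15 * 16 ^ j)).
      by apply: derivableX; exact: derivable_base_cofactor.
    by apply/funext => y; elim: (15 * 16 ^ j)%N => [|k IH]//; rewrite !exprS IH.
  exact: derivableM (derivableM d1 d3) d2.
- rewrite /g !mulf_neq0 ?expf_neq0 ?oppr_eq0 ?invr_eq0//.
  + by apply/prodf_neq0 => i _; apply: Nf; rewrite neq_ltn ltn_ord.
  + by rewrite base_cofactor_neq0 ?expn16_gt0 ?Re_rotated_gt0//; exact: disc_node.
  + apply: infprod_neq0; [exact: tame_factors_shift|exact: disc_node|].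
    by move=> i; apply: Nf; rewrite neq_ltn ltn_addr// orbT.
- move=> z z1; rewrite (infprod_split j.+1 hT z1) big_ord_recr /= -/(tail z).
  rewrite /g {2}/block_factor /block base_factor rotated_node.
  rewrite (_ : (node j - z) / zeta j * _ = (z - node j) * (- (zeta j)^-1 *
    base_cofactor (16 ^ j) (1 - z / zeta j))); last by ring.
  rewrite !exprMn; move: (tail z) (\prod_(i < j) _) ((z - node j) ^+ _) (_ * _ ^+ _) => t p a c.
  ring.
Qed.

Lemma zero_set_nodes : zero_set (node \o block_index).
Proof.
have fib j : [set k | (node \o block_index) k = node j] = [set k | block_index k = j].
  by apply/seteqP; split=> k /= => [/node_inj|->].
split=> [k|w|]; first exact: disc_node.
  have [[k _ <-]|nw] := pselect (range (node \o block_index) w).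
    by rewrite /= fib block_index_fiber; exact/finite_image/finite_II.
  suff -> : [set k | (node \o block_index) k = w] = set0 by [].
  by apply/seteqP; split=> // k kw; apply: nw; exists k.
exists (infprod factor); first exact: dirichlet_infprod_factor.
split=> [_ m [k _ <-]|w [w1 nw]].
  rewrite /= fib => cm.
  have /card_eq_II <- := card_eq_trans (card_esym (card_block_index (block_index k))) cm.
  exact: infprod_factor_multiplicity.
apply: infprod_neq0 => //; first exact: tame_factor.
move=> j; apply: factor_neq0 => //; apply/eqP => wj; apply: nw.
by exists (16 ^ j).-1 => //=; rewrite block_index_start.
Qed.

End Zeros.

(** * Non-Carleson directions and the sum of reciprocal logarithms *)

Section DenseDirections.
Variable R : realType.

Lemma cmod_expi (t : R) : cmod (expi t) = 1.
Proof. by rewrite /cmod /= cos2Dsin2 sqrtr1. Qed.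

(* Pairing with a natural number makes every rational occur at arbitrarily
   large indices. *)
Definition rational_angle (j : nat) : R :=
  if @unpickle (nat * rat)%type j is Some p then ratr p.2 else 0.

(** Pigeonhole: the codes of (i, q) for i <= J are J + 1 distinct numbers, so one of them is at
    least [J]. *)
Lemma rational_angle_recurs (q : rat) J : exists2 j, (J <= j)%N & rational_angle j = ratr q.
Proof.
pose c (i : 'I_J.+1) := pickle (val i, q).
have cI : injective c.
  by move=> i i' /(pcan_inj (@pickleK _)) [] /val_inj.
suff [i Ji] : exists i, (J <= c i)%N.
  by exists (c i) => //; rewrite /rational_angle pickleK.
apply: contrapT => /forallNP cJ.
have cJ' i : (c i < J)%N by rewrite ltnNge; apply/negP; exact: cJ.
have ordI : injective (fun i => Ordinal (cJ' i)) by move=> i i' /(congr1 val) /cI.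
by have := leq_card _ ordI; rewrite !card_ord ltnn.
Qed.

Lemma expi_near_rational (t e : R) J : 0 < e ->
  exists2 j, (J <= j)%N & cmod (expi t - expi (rational_angle j)) < e.
Proof.
move=> e0; have e20 : 0 < e / 2 by rewrite divr_gt0.
have /cvgrPdist_lt/(_ _ e20) hc := @continuous_cos R t.
have /cvgrPdist_lt/(_ _ e20) hs := @continuous_sin R t.
have [r /= r0 hr] := filterI hc hs.
have [|q qt] := @rat_in_itvoo R t (t + r); first by rewrite ltrDl.
have [j Jj jq] := rational_angle_recurs q J; exists j => //; rewrite jq.
have [|hc1 hs1] := hr (ratr q).
  move: qt; rewrite /ball /= in_itv /= => /andP[tq qr].
  by rewrite distrC ger0_norm; lra.
by have /= := cmod_le_ReIm (expi t - expi (ratr q)); lra.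
Qed.

Lemma edist_set_dense (E : set R[i]) (t : R) J :
  (forall j, (J <= j)%N -> E (expi (rational_angle j))) -> edist_set (expi t) E = 0%E.
Proof.
move=> JE; apply/eqP; rewrite eq_le; apply/andP; split.
  apply/lee_addgt0Pr => e e0; rewrite add0e.
  have [j Jj jt] := expi_near_rational t J e0.
  apply: ge_ereal_inf; exists (cmod (expi t - expi (rational_angle j)))%:E; last by rewrite lee_fin ltW.
  by exists (expi (rational_angle j)) => //; exact: JE.
by apply: le_ereal_inf_tmp => _ [w _ <-]; rewrite lee_fin cmod_ge0.
Qed.

(** The distance to [E] vanishes on the circle, so the integrand is constantly +oo on an interval of
    length 2 pi. *)
Lemma not_carleson_dense (E : set R[i]) J :
  (forall j, (J <= j)%N -> E (expi (rational_angle j))) -> ~ carleson_set E.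
Proof.
move=> JE [_ _]; apply/negP; rewrite -leNgt.
rewrite (eq_integral (fun=> +oo%E)); last first.
  by move=> t _; rewrite (edist_set_dense t JE) inve0.
rewrite integral_cst//= lebesgue_measure_itv /= lte_fin mulr_gt0 ?pi_gt0//.
by rewrite -EFinD subr0 gt0_mulye// lte_fin mulr_gt0 ?pi_gt0.
Qed.

End DenseDirections.

(** * Divergence of the reciprocal logarithms over missed blocks *)

Section ReciprocalLogSum.
Variables (R : realType) (zeta : nat -> R[i]).
Hypothesis zeta1 : forall j, cmod (zeta j) = 1.

(** The logarithm equals 16^j ln 2, and ln 2 <= 1. *)
Lemma recip_log_node_ge j :
  (16 ^ j)%:R^-1 <= (ln ((1 - cmod (block_node zeta j))^-1))^-1 :> R.
Proof.
rewrite cmod_node// opprB addrC subrK -exprVn invrK lnXn//.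
have l0 : 0 < ln (2 : R) by rewrite ln_gt0// ltr1n.
have l1 : ln (2 : R) <= 1 by have := @le_ln1Dx R 1; rewrite -natr1; apply; lra.
have n0 : 0 < (16 ^ j)%:R :> R by rewrite ltr0n expn16_gt0.
rewrite -[ln 2 *+ _]mulr_natr lef_pV2 ?posrE ?mulr_gt0//.
by rewrite ler_piMl// ltW.
Qed.

(** A block j missed by [C] has 15 * 16^j terms, each at least 16^-j, so it adds at least 1;
    infinitely many blocks are missed. *)
Lemma esum_recip_log_pinfty (C : set nat) :
  (forall J, exists2 j, (J <= j)%N & forall k, block_index k = j -> ~ C k) ->
  (\esum_(k in ~` C) ((ln ((1 - cmod (block_node zeta (block_index k)))^-1))^-1)%:E = +oo)%E.
Proof.
move=> CJ; pose a k := (ln ((1 - cmod (block_node zeta (block_index k)))^-1))^-1.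
have a0 k : 0 <= a k by apply: le_trans (recip_log_node_ge _); rewrite invr_ge0.
pose P k := k \notin C.
pose u K : R := \sum_(0 <= k < K | P k) a k.
have uN N : exists K, N%:R <= u K.
  elim: N => [|N [K NK]]; first by exists 0%N; rewrite /u big_nil.
  (* This block begins at 16^j - 1 >= j >= K, hence after the indices already summed. *)
  have [j Kj jC] := CJ K.
  have p := expn16_gt0 j.
  have jj : (j < 16 ^ j)%N by rewrite ltn_expl.
  exists (16 ^ j.+1).-1; rewrite -natr1 /u.
  have h1 : (K <= (16 ^ j).-1)%N by lia.
  have h2 : ((16 ^ j).-1 <= (16 ^ j.+1).-1)%N by rewrite expnS; lia.
  rewrite (big_cat_nat (n := K)) ?(leq_trans h1)//= (big_cat_nat h1 h2) /=.
  apply: lerD => //; rewrite -[leLHS]add0r lerD//; first by apply: sumr_ge0.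
  rewrite big_mkcond /=.
  apply: (@le_trans _ _ (\sum_((16 ^ j).-1 <= k < (16 ^ j.+1).-1) (16 ^ j)%:R^-1)).
    rewrite sumr_const_nat.
    have -> : ((16 ^ j.+1).-1 - (16 ^ j).-1 = 15 * 16 ^ j)%N by rewrite expnS; lia.
    by rewrite -[leRHS]mulr_natr natrM mulrCA mulVf ?mulr1 ?ler1n// pnatr_eq0 -lt0n.
  apply: ler_sum_nat => k kj.
  have kE : block_index k = j by apply/eqP; rewrite block_indexP; lia.
  rewrite /P ifT; last by apply/negP => /set_mem; exact: jC.
  by rewrite /a kE recip_log_node_ge.
have -> : ~` C = [set k | P k].
  apply/seteqP; split=> k /=; rewrite /P.
    by move=> nC; apply/negP => /set_mem.
  by move=> /negP nC Ck; apply: nC; exact/mem_set.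
rewrite -(@nneseries_esum R (fun k => (a k)%:E) P (fun k _ => a0 k)).
apply/eqyP => x x0.
have [K xK] := uN (Num.truncn x).+1.
apply: (@le_trans _ _ (u K)%:E).
  by rewrite lee_fin (le_trans _ xK)// ltW// truncnS_gt.
rewrite /u -sumEFin; apply: nneseries_lim_ge => k _ _.
by rewrite lee_fin.
Qed.

End ReciprocalLogSum.

Theorem corollary9p3 (R : realType) :
  exists z : nat -> R[i],
    [/\ forall n, (@disc R `\ 0) (z n),
        zero_set z &
        ~ exists C : set nat,
            (exists2 E : set R[i], carleson_set E &
               [set z n / (cmod (z n))%:C | n in C] `<=` E) /\
            (\esum_(n in ~` C) ((ln ((1 - cmod (z n))^-1))^-1)%:E < +oo)%E].
Proof.
pose zeta j : R[i] := expi (rational_angle R j).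
have zeta1 j : cmod (zeta j) = 1 by exact: cmod_expi.
exists (block_node zeta \o block_index); split.
- move=> n; split; first exact: disc_node.
  by apply/eqP; exact: node_neq0.
- exact: zero_set_nodes.
move=> [C [[E carE CE] sumC]].
(* Finiteness of the sum yields a [J] from which on every block meets [C]; any index in the
   intersection puts the direction [zeta j] into [E]. *)
have /existsNP[J JC] :
    ~ forall J, exists2 j, (J <= j)%N & forall k, block_index k = j -> ~ C k.
  by move=> /(esum_recip_log_pinfty zeta1) sumE; rewrite /= sumE in sumC.
apply: (@not_carleson_dense R E J _ carE) => j Jj.
apply: contrapT => Ej; apply: JC; exists j => // k kj Ck; apply: Ej.
by apply: CE; exists k => //=; rewrite node_direction// kj.
Qed.
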